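(* Let $n\ge 1$, and consider the autonomous system $$\dot{x}=f(x,\lambda),\qquad \dot{\lambda}=g(x,\lambda),\qquad x\in\mathbb{R}^n,\ \lambda\in\mathbb{R},$$ where $f:\mathbb{R}^n\times\mathbb{R}\to\mathbb{R}^n$ and $g:\mathbb{R}^n\times\mathbb{R}\to\mathbb{R}$ are continuous, locally Lipschitz, and differentiable at the origin, with $f(0,0)=0$, $g(0,0)=0$, and $$\frac{\partial f}{\partial x}(0,0)=A,\quad \frac{\partial f}{\partial \lambda}(0,0)=b,\quad \frac{\partial g}{\partial x}(0,0)=0,\quad \frac{\partial g}{\partial \lambda}(0,0)=0,$$ where $A\in\mathbb{R}^{n\times n}$, $b\in\mathbb{R}^n$, and all eigenvalues of $A$ have negative real parts. Let $g$ be differentiable at least twice, let $G\in\mathbb{R}^{(n+1)\times(n+1)}$ be the Hessian of $g$ (with respect to $(x,\lambda)$) at the origin, and suppose that $G$ is sign-definite. Then $(0,0)$ is a weak (Milnor) attractor for the system.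
   Context: A symmetric matrix is sign-definite if it is either positive definite or negative definite. An equilibrium is a weak (Milnor) attractor if the set of initial conditions whose forward solutions are defined for all $t\ge 0$ and converge to the equilibrium as $t\to\infty$ has strictly positive Lebesgue measure; this set need not be a neighborhood of the equilibrium, and the equilibrium need not be Lyapunov stable. *)

(* Defs.v *)
From HB Require Import structures.
From mathcomp Require Import all_boot all_order all_algebra.
From mathcomp Require Import complex.
From mathcomp Require Import all_classical all_reals all_analysis.

Set Implicit Arguments.
Unset Strict Implicit.
Unset Printing Implicit Defensive.

Import Order.TTheory GRing.Theory Num.Theory.
Import numFieldNormedType.Exports.

Local Open Scope classical_set_scope.
Local Open Scope ring_scope.

(* R^n x R is identified with R^(n+1), the last coordinate being lambda. *)
Definition lam_part (R : realType) (n : nat) (z : 'cV[R]_(n + 1)) : R :=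
  z (rshift n ord0) ord0.

Definition joint (R : realType) (n : nat) (T : Type)
    (h : 'cV[R]_n -> R -> T) (z : 'cV[R]_(n + 1)) : T :=
  h (usubmx z) (lam_part z).

Definition locally_lipschitz (R : realType) (V W : normedModType R)
    (h : V -> W) : Prop :=
  forall z : V, exists2 U : set V, nbhs z U & [lipschitz h w | w in U].

Definition partial (R : realType) (m : nat) (h : 'cV[R]_m -> R) (i : 'I_m)
    (z : 'cV[R]_m) : R :=
  'D_(delta_mx i ord0) h z.

Definition gradient (R : realType) (m : nat) (h : 'cV[R]_m -> R)
    (z : 'cV[R]_m) : 'cV[R]_m :=
  \col_i partial h i z.

Definition hessian (R : realType) (m : nat) (h : 'cV[R]_m -> R)
    (z : 'cV[R]_m) : 'M[R]_m :=
  \matrix_(i, j) partial (partial h i) j z.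

(* Twice Frechet differentiability at a point: the derivative exists near z
   and, represented by the gradient, is itself differentiable at z. *)
Definition twice_differentiable_at (R : realType) (m : nat)
    (h : 'cV[R]_m -> R) (z : 'cV[R]_m) : Prop :=
  (\forall w \near z, differentiable h w) /\ differentiable (gradient h) z.

Definition pos_definite (R : realType) (m : nat) (M : 'M[R]_m) : Prop :=
  forall v : 'cV[R]_m, v != 0 -> 0 < (v^T *m M *m v) ord0 ord0.

Definition neg_definite (R : realType) (m : nat) (M : 'M[R]_m) : Prop :=
  forall v : 'cV[R]_m, v != 0 -> (v^T *m M *m v) ord0 ord0 < 0.

Definition sign_definite (R : realType) (m : nat) (M : 'M[R]_m) : Prop :=
  M^T = M /\ (pos_definite M \/ neg_definite M).

Definition hurwitz (R : realType) (n : nat) (A : 'M[R]_n) : Prop :=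
  forall mu : R[i],
    eigenvalue (map_mx (real_complex R) A) mu -> complex.Re mu < 0.

Definition box (R : realType) (m : nat) (a b : 'cV[R]_m) : set 'cV[R]_m :=
  [set z : 'cV[R]_m | forall i, a i ord0 <= z i ord0 <= b i ord0].

Definition box_volume (R : realType) (m : nat) (a b : 'cV[R]_m) : R :=
  \prod_(i < m) Num.max 0 (b i ord0 - a i ord0).

(* Lebesgue outer measure on R^m for m > 0, as the infimum of the total volumes
   of countable covers by boxes; its restriction to the
   Caratheodory-measurable sets is the (complete) Lebesgue measure. *)
Definition lebesgue_outer (R : realType) (m : nat) (E : set 'cV[R]_m) : \bar R :=
  ereal_inf [set s : \bar R | exists a b : nat -> 'cV[R]_m,
    E `<=` \bigcup_k box (a k) (b k) /\
    s = (\sum_(0 <= k <oo) (box_volume (a k) (b k))%:E)%E].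

Definition lebesgue_measurable (R : realType) (m : nat) (E : set 'cV[R]_m) : Prop :=
  (@lebesgue_outer R m).-caratheodory E.

(* For a Lebesgue measurable B this says exactly that the measure of B is
   positive (take E = B, or use monotonicity); for an arbitrary B it is
   stronger than positivity of the outer measure. *)
Definition positive_lebesgue_measure (R : realType) (m : nat)
    (B : set 'cV[R]_m) : Prop :=
  exists E : set 'cV[R]_m,
    [/\ lebesgue_measurable E, E `<=` B & (0 < lebesgue_outer E)%E].

(* Only the values at t >= 0 matter. Continuity at 0 from the right together
   with the equation for t > 0 gives the one-sided derivative at 0. *)
Definition forward_solution (R : realType) (n : nat)
    (f : 'cV[R]_n -> R -> 'cV[R]_n) (g : 'cV[R]_n -> R -> R)
    (x : R -> 'cV[R]_n) (l : R -> R) : Prop :=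
  [/\ {within `[0, +oo[, continuous x},
      {within `[0, +oo[, continuous l},
      forall t : R, 0 < t -> is_derive t 1 x (f (x t) (l t)) &
      forall t : R, 0 < t -> is_derive t 1 l (g (x t) (l t))].

Definition basin (R : realType) (n : nat)
    (f : 'cV[R]_n -> R -> 'cV[R]_n) (g : 'cV[R]_n -> R -> R)
    (xe : 'cV[R]_n) (le : R) : set 'cV[R]_(n + 1) :=
  [set z | exists (x : R -> 'cV[R]_n) (l : R -> R),
    [/\ forward_solution f g x l,
        x 0 = usubmx z, l 0 = lam_part z,
        x t @[t --> +oo] --> xe &
        l t @[t --> +oo] --> le]].

Definition weak_attractor (R : realType) (n : nat)
    (f : 'cV[R]_n -> R -> 'cV[R]_n) (g : 'cV[R]_n -> R -> R)
    (xe : 'cV[R]_n) (le : R) : Prop :=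
  [/\ f xe le = 0, g xe le = 0 & positive_lebesgue_measure (basin f g xe le)].

(* Main.v *)
Require Import Defs.
From HB Require Import structures.
From mathcomp Require Import all_boot all_order all_algebra.
From mathcomp Require Import complex.
From mathcomp Require Import all_classical all_reals all_analysis.
From mathcomp Require Import measurable_realfun ring lra.
Set Implicit Arguments.
Unset Strict Implicit.
Unset Printing Implicit Defensive.
Import Order.TTheory GRing.Theory Num.Theory.
Import numFieldNormedType.Exports.
Local Open Scope classical_set_scope.
Local Open Scope ring_scope.

(** Let q = A^-1 b and y = x + lambda q, so that y' = A y + o(|x| + |lambda|), and
    let V be a quadratic Lyapunov function of y' = A y.  Up to the sign s of the
    Hessian, s g lies between two positive multiples of |x|^2 + lambda^2 near 0.
    Consider the half-cone s lambda < 0, V(y) < lambda^2, cut at a small height.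
    There |x| = O(|lambda|), so W = V(y) - lambda^2 satisfies W' <= - 2 alpha W for
    some alpha > 0 and W stays negative; also (s lambda)' is at least a
    multiple of lambda^2, while it is at most a multiple of |lambda|, so
    s lambda increases to 0 without reaching it in finite time.  Hence every
    solution starting in the half-cone stays there and converges to 0, and the
    half-cone is open. *)

(** * Lebesgue outer measure of boxes *)

(** Near 0 and away from it [s g] is positive, so s lambda increases: a solution with s lambda > 0
    cannot converge to 0 without first moving away. Only the side s lambda < 0 is captured, and 0
    lies on the boundary of the half-cone. The shear by q removes the term lambda b, which would
    otherwise enter W' at order lambda^2 with no small factor. Comparing W' with - 2 alpha W, where
    W < 0, instead of asking V alone to decay, leaves a reserve 2 alpha lambda^2 for the errors: the
    linear remainder, of order eps lambda^2, and the contributions of g, of order |lambda|^3. The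
    reserve is met by fixing eps first and the height of the half-cone last. A locally Lipschitz
    field need not have solutions for all times. It is therefore modified outside a ball into a
    bounded, globally Lipschitz field; invariance is proved for the modified field, and the
    half-cone lies in the ball where both fields agree. Positivity of the measure comes down to a
    lower bound for every countable cover of a box, obtained by integrating indicators. *)

Section BoxCovers.
Variable R : realType.
Implicit Types (al be c : nat -> R) (l u : nat -> nat -> R).

Local Notation mu := (@lebesgue_measure R).

Lemma integral_indic_segment_le (a b p q : R) :
  (\int[mu]_(s in `[a, b]) (\1_(`[p, q] : set R) s)%:E <= (Num.max 0 (q - p))%:E)%E.
Proof.
rewrite integral_indic//.
apply: (@le_trans _ _ (mu `[p, q])).
  by apply: le_measure; rewrite ?inE//; apply: measurableI.
rewrite lebesgue_measure_itv/= lte_fin; case: ifPn => pq.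
  by rewrite -EFinD lee_fin le_max lexx orbT.
by rewrite lee_fin le_max lexx.
Qed.

(* Integrating the covering inequality in the last coordinate removes that
   coordinate and multiplies the weights by the side lengths. *)
Lemma weighted_cover_volume m al be l u c (D : R) :
  (forall i, al i <= be i) -> (forall k, 0 <= c k) -> 0 <= D ->
  (forall z : nat -> R, (forall i, (i < m)%N -> al i <= z i <= be i) ->
    (D%:E <= \sum_(0 <= k <oo)
       (c k * \prod_(i < m) \1_(`[l k i, u k i] : set R) (z i))%:E)%E) ->
  ((D * \prod_(i < m) (be i - al i))%:E <= \sum_(0 <= k <oo)
     (c k * \prod_(i < m) Num.max 0 (u k i - l k i))%:E)%E.
Proof.
(* The bounds are sequences indexed by all of [nat], so dropping a coordinate leaves them unchanged;
   only the weights [c] and the constant [D] vary in the induction. *)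
move=> albe; elim: m c D => [|m IH] c D c0 D0 cover.
  have E d : (\sum_(0 <= k <oo) (c k * \prod_(i < 0) d k i)%:E = \sum_(0 <= k <oo) (c k)%:E)%E.
    by apply: eq_eseriesr => k _; rewrite big_ord0 mulr1.
  by have := cover (fun=> 0); rewrite big_ord0 mulr1 !E; exact.
pose c' k := c k * Num.max 0 (u k m - l k m).
have c'0 k : 0 <= c' k by rewrite mulr_ge0// le_max lexx.
rewrite big_ord_recr/= mulrA mulrAC.
rewrite (_ : (\sum_(0 <= k <oo) _)%E = (\sum_(0 <= k <oo)
    (c' k * \prod_(i < m) Num.max 0 (u k i - l k i))%:E)%E); last first.
  by apply: eq_eseriesr => k _; rewrite big_ord_recr/= /c' mulrA mulrAC.

apply: IH => // [|z zm]; first by rewrite mulr_ge0// subr_ge0.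
pose w k := c k * \prod_(i < m) \1_(`[l k i, u k i] : set R) (z i).
have w0 k : 0 <= w k by rewrite mulr_ge0// prodr_ge0.
pose D1 : set R := `[al m, be m]%classic.
have mD1 : measurable D1 by exact: measurable_itv.
have -> : ((D * (be m - al m))%:E = \int[mu]_(s in D1) (cst D%:E s))%E.
  have muD1 : mu D1 = (be m - al m)%:E.
    rewrite lebesgue_measure_itv/= lte_fin.
    by case: ltgtP (albe m) => // -> _; rewrite subrr.
  by rewrite integral_cst// EFinM -muD1.
have mw k (d : R) : measurable_fun D1 (fun s => (d * \1_(`[l k m, u k m] : set R) s)%:E).
  apply/measurable_EFinP; apply: measurable_funM; first exact: measurable_cst.
  by apply: measurable_indic; exact: measurable_itv.
apply: (@le_trans _ _ (\int[mu]_(s in D1)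
   (\sum_(0 <= k <oo) (w k * \1_(`[l k m, u k m] : set R) s)%:E))%E).
  apply: ge0_le_integral => //=.
  - apply: (@ge0_emeasurable_sum _ _ _ _
      (fun k s => (w k * \1_(`[l k m, u k m] : set R) s)%:E) xpredT).
    + by move=> k s _ _; rewrite lee_fin mulr_ge0.
    + by move=> k _; exact: mw.
  - move=> s; rewrite /D1/= in_itv/= => sD.
    have := cover (fun i => if i == m then s else z i) _.
    rewrite (_ : (\sum_(0 <= k <oo) _)%E = (\sum_(0 <= k <oo)
       (w k * \1_(`[l k m, u k m] : set R) s)%:E)%E); first apply.
      move=> i; rewrite ltnS leq_eqVlt; case: eqP => [->//|_/=]; exact: zm.
    apply: eq_eseriesr => k _; congr (_%:E).
    rewrite /w big_ord_recr/= eqxx mulrA; congr (_ * _ * _).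
    by apply: eq_bigr => i _; rewrite ltn_eqF.
rewrite integral_nneseries//; first last.
- by move=> k s _; rewrite lee_fin mulr_ge0.
- by move=> k; exact: mw.
apply: lee_nneseries => [k _ _|k _].
  by apply: integral_ge0 => s _; rewrite lee_fin mulr_ge0.
under eq_integral do rewrite EFinM.
rewrite ge0_integralZl//; first last.
- by rewrite lee_fin.
- by have := mw k 1; under eq_fun do rewrite mul1r.
have -> : c' k * \prod_(i < m) \1_(`[l k i, u k i] : set R) (z i) =
    w k * Num.max 0 (u k m - l k m) by rewrite /c' /w mulrAC.
rewrite [leRHS]EFinM lee_pmul ?lee_fin//.
  by apply: integral_ge0 => s _; rewrite lee_fin.
exact: integral_indic_segment_le.
Qed.

End BoxCovers.

(** * Subadditivity of the outer measure and Caratheodory measurability of boxes *)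

Section LebesgueOuter.
Variables (R : realType) (m : nat).
Implicit Types (a b : 'cV[R]_m) (E X Y H : set 'cV[R]_m).

Lemma box_volume_ge0 a b : 0 <= box_volume a b.
Proof. by apply: prodr_ge0 => i _; rewrite le_max lexx. Qed.

Lemma lebesgue_outer_ge0 E : (0 <= lebesgue_outer E)%E.
Proof.
apply: le_ereal_inf_tmp => _ [a [b [_ ->]]].
by apply: nneseries_ge0 => k _ _; rewrite lee_fin box_volume_ge0.
Qed.

Lemma lebesgue_outer_le_cover E (a b : nat -> 'cV[R]_m) :
  E `<=` \bigcup_k box (a k) (b k) ->
  (lebesgue_outer E <= \sum_(0 <= k <oo) (box_volume (a k) (b k))%:E)%E.
Proof. by move=> Eab; apply: ereal_inf_lbound; exists a, b. Qed.

(** In dimension 0 every box has volume 1, an empty product, so every sequence of boxes has infinite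
    total volume; hence [0 < m]. *)
Lemma lebesgue_outer0 : (0 < m)%N -> lebesgue_outer (set0 : set 'cV[R]_m) = 0%E.
Proof.
move=> m0; apply/eqP; rewrite eq_le lebesgue_outer_ge0 andbT.
apply: le_trans (@lebesgue_outer_le_cover set0 (fun=> 0) (fun=> 0) _) _ => //.
rewrite eseries0// => k _ _.
by rewrite /box_volume (bigD1 (Ordinal m0))//= !mxE subrr maxxx mul0r.
Qed.

Lemma le_add_ereal_inf (x : \bar R) (S T : set (\bar R)) :
  (forall s, S s -> 0 <= s)%E -> (forall t, T t -> 0 <= t)%E ->
  (forall s t, S s -> T t -> x <= s + t)%E ->
  (x <= ereal_inf S + ereal_inf T)%E.
Proof.
have add_inf (y : \bar R) (U : set (\bar R)) : (0 <= y)%E -> (forall t, U t -> 0 <= t)%E ->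
    (forall t, U t -> x <= t + y)%E -> (x <= ereal_inf U + y)%E.
  case: y => [y| |] // y0 U0 xU.
    by rewrite -leeBlDr//; apply: le_ereal_inf_tmp => t Ut; rewrite leeBlDr// xU.
  rewrite addey ?leey// gt_eqF// (lt_le_trans ltNy0)//.
  by apply: le_ereal_inf_tmp => t /U0.
move=> S0 T0 xST; apply: (add_inf) => // [|s Ss]; first exact: le_ereal_inf_tmp.
rewrite addeC; apply: add_inf => // [|t Tt]; first exact: S0.
by rewrite addeC xST.
Qed.

(** The two covers are interleaved by parity. As volumes are nonnegative, the first [N] terms are
    bounded by the first [N.*2], which split into [N] terms of each cover. *)
Lemma lebesgue_outerU X Y :
  (lebesgue_outer (X `|` Y) <= lebesgue_outer X + lebesgue_outer Y)%E.
Proof.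
have vol0 (c d : nat -> 'cV[R]_m) k : (0 <= (box_volume (c k) (d k))%:E)%E.
  by rewrite lee_fin box_volume_ge0.
apply: le_add_ereal_inf => [_ [a [b [_ ->]]]|_ [a [b [_ ->]]]|].
- exact: nneseries_ge0.
- exact: nneseries_ge0.
move=> _ _ [a [b [Xab ->]]] [c [d [Ycd ->]]].
pose p k := if odd k then c k./2 else a k./2.
pose q k := if odd k then d k./2 else b k./2.
apply: (@le_trans _ _ (\sum_(0 <= k <oo) (box_volume (p k) (q k))%:E)%E).
  apply: lebesgue_outer_le_cover => z [/Xab|/Ycd] [k _ zk].
  - by exists k.*2 => //; rewrite /p /q odd_double doubleK.
  - by exists k.*2.+1 => //; rewrite /p /q /= odd_double/= uphalf_double.
have partial N : (\sum_(0 <= k < N.*2) (box_volume (p k) (q k))%:E =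
    \sum_(0 <= k < N) (box_volume (a k) (b k))%:E +
    \sum_(0 <= k < N) (box_volume (c k) (d k))%:E)%E.
  elim: N => [|N IH]; first by rewrite !big_geq// adde0.
  rewrite doubleS !big_nat_recr//= IH /p /q /= odd_double/= doubleK uphalf_double.
  by rewrite -addeA addeACA.
apply: lime_le; first exact: is_cvg_nneseries.
apply: nearW => N; apply: (@le_trans _ _ (\sum_(0 <= k < N.*2) (box_volume (p k) (q k))%:E)%E).
  by apply: lee_sum_nneg_natr => //; rewrite -addnn leq_addr.
by rewrite partial leeD// nneseries_lim_ge.
Qed.

Lemma lebesgue_measurableI X Y :
  lebesgue_measurable X -> lebesgue_measurable Y -> lebesgue_measurable (X `&` Y).
Proof.
move=> mX mY E; rewrite (mX E) (mY (E `&` X)) (mX (E `&` ~` (X `&` Y))) addeA.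
congr (_ + _)%E; [congr (_ + _)%E|].
- by rewrite setIA.
- congr lebesgue_outer; apply/seteqP; split=> z /=; tauto.
- congr lebesgue_outer; apply/seteqP; split=> z /=; tauto.
Qed.

Lemma lebesgue_measurableC X : lebesgue_measurable (~` X) -> lebesgue_measurable X.
Proof. by move=> mX E; rewrite (mX E) setCK addeC. Qed.

Lemma box_volume_split (i : 'I_m) (c : R) a b :
  box_volume a b =
  box_volume a (\col_j if j == i then Num.min (b j ord0) c else b j ord0) +
  box_volume (\col_j if j == i then Num.max (a j ord0) c else a j ord0) b.
Proof.
have split1 (p q : R) : Num.max 0 (q - p) =
    Num.max 0 (Num.min q c - p) + Num.max 0 (q - Num.max p c).
  by case: (leP q c) => ?; case: (leP p c) => ?; do ![case: leP => ?]; lra.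
have volD1 (p q : 'cV[R]_m) : box_volume p q =
    Num.max 0 (q i ord0 - p i ord0) * \prod_(j < m | j != i) Num.max 0 (q j ord0 - p j ord0).
  by rewrite /box_volume (bigD1 i).
rewrite !volD1 !mxE eqxx split1 mulrDl.
by congr (_ * _ + _ * _); apply: eq_bigr => j /negbTE ji; rewrite mxE ji.
Qed.

(* A box is cut by the hyperplane z_i = c into two boxes whose volumes add up. *)
Lemma lebesgue_measurable_halfspace (i : 'I_m) (c : R) H :
  (forall z, H z -> z i ord0 <= c) -> (forall z, ~ H z -> c <= z i ord0) ->
  lebesgue_measurable H.
Proof.
move=> Hle Hge X; apply/eqP; rewrite eq_le; apply/andP; split.
  by rewrite -[X in lebesgue_outer X](setUIDK X H) setDE lebesgue_outerU.
apply: le_ereal_inf_tmp => _ [a [b [Xab ->]]].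
under eq_eseriesr => k _ do rewrite (box_volume_split i c) EFinD.
rewrite nneseriesD => [|k _ _|k _ _]; rewrite ?lee_fin ?box_volume_ge0//.
apply: leeD; apply: lebesgue_outer_le_cover => z [/Xab[k _ zk] zH]; exists k => // j.
- rewrite mxE; have := zk j; case: eqP => // -> /andP[-> /=].
  by rewrite le_min => ->; exact: Hle.
- rewrite mxE; have := zk j; case: eqP => // -> /andP[/= az ->].
  by rewrite ge_max az andbT; exact: Hge.
Qed.

Lemma lebesgue_measurable_box a b : (0 < m)%N -> lebesgue_measurable (box a b).
Proof.
move=> m0.
rewrite (_ : box a b = \big[setI/setT]_(i < m)
  ([set z : 'cV[R]_m | z i ord0 <= b i ord0] `&`
   [set z : 'cV[R]_m | a i ord0 <= z i ord0])); last first.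
  rewrite -bigcap_seq; apply/seteqP; split=> z /=.
    by move=> zab i _; have /andP[] := zab i.
  by move=> zab i; have [/= -> ->] := zab i (mem_index_enum i).
elim/big_ind : _ => [X|X Y|i _]; [|exact: lebesgue_measurableI|].
  by rewrite setIT setCT setI0 lebesgue_outer0// adde0.
apply: lebesgue_measurableI.
  by apply: (@lebesgue_measurable_halfspace i (b i ord0)) => // z /negP; rewrite -ltNge => /ltW.
(* The complement is the open half-space below [a i ord0]; the half-space lemma leaves the status of
   the boundary hyperplane free. *)
apply: lebesgue_measurableC.
apply: (@lebesgue_measurable_halfspace i (a i ord0)) => z /=.
  by move=> /negP; rewrite -ltNge => /ltW.
by move=> /contrapT.
Qed.

End LebesgueOuter.

Lemma lebesgue_outer_box_gt0 (R : realType) (m : nat) (a b : 'cV[R]_m) :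
  (forall i, a i ord0 < b i ord0) -> (0 < lebesgue_outer (box a b))%E.
Proof.
case: m a b => [|m] a b ab.
  (* in dimension 0 every box is the whole space and has volume 1 *)
  apply: (@lt_le_trans _ _ 1%E) => //; apply: le_ereal_inf_tmp => _ [c [d [_ ->]]].
  apply: (le_trans _ (@nneseries_lim_ge _ _ xpredT 0 1%N _)).
    by rewrite big_nat1 /box_volume big_ord0.
  by move=> k _ _; rewrite lee_fin box_volume_ge0.
apply: (@lt_le_trans _ _ (\prod_(i < m.+1) (b i ord0 - a i ord0))%:E).
  by rewrite lte_fin prodr_gt0// => i _; rewrite subr_gt0.
apply: le_ereal_inf_tmp => _ [c [d [cov ->]]].
have := @weighted_cover_volume R m.+1 (fun i => a (inord i) ord0)
  (fun i => b (inord i) ord0) (fun k i => c k (inord i) ord0)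
  (fun k i => d k (inord i) ord0) (fun=> 1) 1.
rewrite mul1r; under eq_bigr do rewrite inord_val.
have -> : (\sum_(0 <= k <oo) (1 * \prod_(i < m.+1)
    Num.max 0 (d k (inord i) ord0 - c k (inord i) ord0))%:E)%E =
    (\sum_(0 <= k <oo) (box_volume (c k) (d k))%:E)%E.
  apply: eq_eseriesr => k _; rewrite mul1r; congr (_%:E).
  by apply: eq_bigr => i _; rewrite inord_val.
apply=> // [i|z zab]; first exact: ltW.
(* The point lies in some box [k] of the cover, whose product of indicators is 1; the partial sum up
   to [k.+1] is then already at least 1. *)
have [|k _ zk] := cov (\col_i z i).
  by move=> i; rewrite mxE; have := zab i (ltn_ord i); rewrite inord_val.
have ge0 j : (0 <= (1 * \prod_(i < m.+1)
    \1_(`[c j (inord i) ord0, d j (inord i) ord0] : set R) (z i))%:E)%E.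
  by rewrite lee_fin mulr_ge0// prodr_ge0.
apply: (le_trans _ (@nneseries_lim_ge _ _ xpredT 0 k.+1 _)); last by move=> j _ _.
rewrite big_nat_recr//= -[leLHS]add0e leeD//; first exact: sume_ge0.
rewrite mul1r big1// => i _; rewrite indicE mem_set//= in_itv/=.
by have := zk i; rewrite mxE inord_val.
Qed.

Lemma positive_lebesgue_measure_nbhs (R : realType) (m : nat) (z : 'cV[R]_m)
    (B : set 'cV[R]_m) :
  (0 < m)%N -> nbhs z B -> positive_lebesgue_measure B.
Proof.
move=> m0 /nbhs_ballP[e /= e0 eB].
(* Balls of the maximum norm are cubes, so the cube of half-side [e / 2] fits inside. *)
exists (box (z - const_mx (e / 2)) (z + const_mx (e / 2))); split.
- exact: lebesgue_measurable_box.
- move=> w zw; apply: eB; split => // i j; rewrite (ord1 j).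
  have := zw i; rewrite !mxE /ball/= ltr_distlC => /andP[? ?]; apply/andP; split; lra.
- by apply: lebesgue_outer_box_gt0 => i; rewrite !mxE; lra.
Qed.

(** * Global solutions of Lipschitz differential equations *)

Section Ode.
Variable R : realType.

Lemma ge0_is_derive_le (g dg : R -> R) (a b : R) : a <= b ->
  (forall t, a <= t <= b -> is_derive t 1 g (dg t)) ->
  (forall t, a < t < b -> 0 <= dg t) -> g a <= g b.
Proof.
rewrite le_eqVlt => /predU1P[<- //|ab] g' dg0; rewrite -subr_ge0.
have [t tab||c cab ->] := @MVT R g dg a b ab.
- by apply: g'; move: tab; rewrite in_itv/= => /andP[/ltW-> /ltW->].
- apply: derivable_within_continuous => t tab.
  by case: (g' t) => //; move: tab; rewrite in_itv.
- apply: mulr_ge0; last by rewrite subr_ge0 ltW.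
  by apply: dg0; move: cab; rewrite in_itv.
Qed.

Lemma le_is_derive_le (g dg h dh : R -> R) (a b : R) : a <= b ->
  (forall t, a <= t <= b -> is_derive t 1 g (dg t)) ->
  (forall t, a <= t <= b -> is_derive t 1 h (dh t)) ->
  (forall t, a < t < b -> dg t <= dh t) -> g b - g a <= h b - h a.
Proof.
move=> ab g' h' gh.
have : (h \- g) a <= (h \- g) b.
  apply: (@ge0_is_derive_le _ (dh \- dg)) => // t tab.
    by have := g' t tab; have := h' t tab => ? ?; exact: is_deriveB.
  by rewrite /= subr_ge0 gh.
rewrite /=; lra.
Qed.

(** Stands in for bounding the norm of an integral by the integral of a majorant, [h] being a known
    primitive of the majorant. *)
Lemma norm_is_derive_le (g dg h dh : R -> R) (a b : R) : a <= b ->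
  (forall t, a <= t <= b -> is_derive t 1 g (dg t)) ->
  (forall t, a <= t <= b -> is_derive t 1 h (dh t)) ->
  (forall t, a < t < b -> `|dg t| <= dh t) -> `|g b - g a| <= h b - h a.
Proof.
move=> ab g' h' gh; rewrite ler_norml lerNl; apply/andP; split.
- have := @le_is_derive_le (\- g) (\- dg) h dh a b ab _ h' _.
  rewrite /= opprD; apply=> t tab; first by have := g' t tab => ?; exact: is_deriveN.
  by have := gh t tab; rewrite ler_norml => /andP[]; lra.
- apply: (@le_is_derive_le g dg h dh) => // t tab.
  by have := gh t tab; rewrite ler_norml => /andP[].
Qed.

(* Integrating from -1 makes the derivative at 0 two-sided. *)
Definition primitive (u : R -> R) (t : R) : R :=
  \int[lebesgue_measure]_(s in `[-1, t]) u s - \int[lebesgue_measure]_(s in `[-1, 0]) u s.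

Lemma primitive0 u : primitive u 0 = 0.
Proof. exact: subrr. Qed.

Lemma is_derive_primitive u (t : R) : continuous u -> -1 < t ->
  is_derive t 1 (primitive u) (u t).
Proof.
move=> cu t1; have tt1 : t < t + 1 by rewrite ltrDl.
have [|dU] := @continuous_FTC1_closed R u (-1) t (t + 1) tt1 _ t1 (cu t).
  apply: continuous_compact_integrable; first exact: segment_compact.
  exact: continuous_subspaceT.
rewrite derive1E => U'.
have -> : u t = u t - 0 by rewrite subr0.
by apply: is_deriveB; apply: DeriveDef.
Qed.

Lemma cV_norm_le (m : nat) (v : 'cV[R]_m) (e : R) : 0 <= e ->
  (forall i, `|v i ord0| <= e) -> `|v| <= e.
Proof.
move=> e0 ve; rewrite [leLHS]/Num.Def.normr/= mx_normrE (bigmax_le _ e0)//= => -[i j] _.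
by rewrite (ord1 j).
Qed.

Lemma cV_norm_ge (m : nat) (v : 'cV[R]_m) i : `|v i ord0| <= `|v|.
Proof.
by rewrite [leRHS]/Num.Def.normr/= mx_normrE; exact: (le_bigmax _ _ (i, ord0)).
Qed.

Lemma is_derive_cV (m : nat) (M : R -> 'cV[R]_m) (t : R) (dM : 'cV[R]_m) :
  (forall i, is_derive t 1 (fun s => M s i ord0) (dM i ord0)) -> is_derive t 1 M dM.
Proof.
move=> M'; have dM' : derivable M t 1.
  by apply/derivable_mxP => i j; rewrite (ord1 j); case: (M' i).
apply: DeriveDef => //; rewrite derive_mx//; apply/matrixP => i j.
by rewrite mxE (ord1 j); case: (M' i).
Qed.

Lemma is_derive_cV_coord (m : nat) (M : R -> 'cV[R]_m) (t : R) (dM : 'cV[R]_m) i :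
  is_derive t 1 M dM -> is_derive t 1 (fun s => M s i ord0) (dM i ord0).
Proof.
case=> dM' <-; have /derivable_mxP dMi := dM'.
by apply: DeriveDef => //; rewrite derive_mx// mxE.
Qed.

Lemma le0_geometric (x c : R) : (forall k, x <= c / 2 ^+ k) -> x <= 0.
Proof.
move=> xc; rewrite leNgt; apply/negP => x0.
have := xc (Num.truncn (c / x)); rewrite ler_pdivlMr ?exprn_gt0// mulrC.
apply/negP; rewrite -ltNge -ltr_pdivrMr//; apply: (lt_le_trans (truncnS_gt _)).
by rewrite -natrX ler_nat ltn_expl.
Qed.

(* The limit is the supremum of the nondecreasing minorants [u k - 2 c / 2^k]. *)
Lemma geometric_cauchy_limit (u : nat -> R) (c : R) :
  (forall k, `|u k.+1 - u k| <= c / 2 ^+ k) ->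
  exists l, forall k, `|u k - l| <= 2 * c / 2 ^+ k.
Proof.
move=> uc; pose a k := u k - 2 * c / 2 ^+ k; pose b k := u k + 2 * c / 2 ^+ k.
have half k : 2 * c / 2 ^+ k.+1 = c / 2 ^+ k.
  by rewrite exprS invfM mulrACA divff// mul1r.
have c2 k : 2 * c / 2 ^+ k = c / 2 ^+ k + c / 2 ^+ k by rewrite -mulrA; ring.
have aS k : a k <= a k.+1.
  by rewrite /a half c2; have := uc k; rewrite ler_norml => /andP[]; lra.
have bS k : b k.+1 <= b k.
  by rewrite /b half c2; have := uc k; rewrite ler_norml => /andP[]; lra.
have c0 k : 0 <= c / 2 ^+ k by exact: le_trans (uc k).
have ab k : a k <= b k by rewrite /a /b c2; have := c0 k; lra.
have aM : {homo a : i j / (i <= j)%N >-> i <= j} by apply: homo_leq => // ? ? ?; exact: le_trans.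
have bM : {homo b : i j / (i <= j)%N >-> j <= i}.
  by apply: (@homo_leq _ _ (fun x y => y <= x)) => // y x z xy yz; exact: le_trans yz xy.
have abb i j : a i <= b j.
  have [ij|/ltnW ji] := leqP i j; first exact: le_trans (aM _ _ ij) (ab j).
  exact: le_trans (ab i) (bM _ _ ji).
have supa : has_sup (range a).
  by split; [exists (a 0%N), 0%N|exists (b 0%N) => _ [i _ <-]].
exists (sup (range a)) => k; rewrite ler_norml.
have : a k <= sup (range a) by apply: sup_upper_bound => //; exists k.
have : sup (range a) <= b k by apply: ge_sup => [|_ [i _ <-]//]; exists (a 0%N), 0%N.
rewrite /a /b; lra.
Qed.

Lemma continuous_lipschitz (V W : normedModType R) (h : V -> W) (C : R) :
  (forall v w, `|h v - h w| <= C * `|v - w|) -> continuous h.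
Proof.
move=> hlip v; apply/(@cvgrPdist_le _ _ _ (nbhs v)) => e e0.
have C0 : 0 < `|C| + 1 by rewrite ltr_pwDr.
apply/nbhs_ballP; exists ((`|C| + 1)^-1 * e) => /=; first by rewrite mulr_gt0// invr_gt0.
move=> w; rewrite -ball_normE/= => /ltW vw; apply: le_trans (hlip _ _) _.
apply: (@le_trans _ _ ((`|C| + 1) * `|v - w|)).
  by rewrite ler_wpM2r// (le_trans (ler_norm _))// lerDl.
by rewrite -ler_pdivlMl.
Qed.

Section Picard.
Variables (m : nat) (F : 'cV[R]_m -> 'cV[R]_m) (L B : R) (z0 : 'cV[R]_m).
Hypothesis L0 : 0 < L.
Hypothesis F_lip : forall z w, `|F z - F w| <= L * `|z - w|.
Hypothesis F_bnd : forall z, `|F z| <= B.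

Let pic (y : R -> 'cV[R]_m) (t : R) : 'cV[R]_m :=
  z0 + \col_i primitive (fun s => F (y s) i ord0) t.

(* The iterates are compared in the norm weighted by e^(-2Lt), for which the
   Picard map is a contraction with ratio 1/2 on the whole half-line. *)
Let growth (t : R) : R := expR (2 * L * t).

Let growth_ge0 t : 0 <= growth t.
Proof. exact: expR_ge0. Qed.

Let is_derive_growth (c t : R) : is_derive t 1 (fun s => c * growth s) (c * (2 * L * growth t)).
Proof.
have d1 : is_derive t 1 (fun s : R => 2 * L * s) (2 * L).
  by apply: is_derive_eq; rewrite /= ?scaler0 ?addr0 ?scaler1 /GRing.scale/=; ring.
have d2 : is_derive t 1 growth (2 * L * growth t).
  rewrite mulrC; exact: (@is_derive1_comp _ expR (fun s => 2 * L * s)).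
by apply: is_derive_eq; rewrite /= /GRing.scale/=; ring.
Qed.

Let F_coord_continuous i : continuous (fun z => F z i ord0).
Proof.
apply: (@continuous_lipschitz _ _ _ L) => z w; apply: le_trans (F_lip z w).
by have := cV_norm_ge (F z - F w) i; rewrite !mxE.
Qed.

Let pic0 y : pic y 0 = z0.
Proof. by apply/matrixP => i j; rewrite !mxE primitive0 addr0. Qed.

Let is_derive_pic (y : R -> 'cV[R]_m) (t : R) i : continuous y -> 0 <= t ->
  is_derive t 1 (fun s => pic y s i ord0) (F (y t) i ord0).
Proof.
move=> cy t0; have dP : is_derive t 1 (primitive (fun s => F (y s) i ord0)) (F (y t) i ord0).
  apply: is_derive_primitive; last by apply: lt_le_trans t0; rewrite ltrN10.
  move=> s; apply: (@continuous_comp _ _ _ y (fun z : 'cV[R]_m => F z i ord0) s).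
    exact: cy.
  exact: F_coord_continuous.
rewrite [X in is_derive _ _ X _](_ : _ = cst (z0 i ord0) + primitive (fun s => F (y s) i ord0)).
  by apply: is_derive_eq; rewrite add0r.
by apply/funext => s; rewrite /pic !mxE.
Qed.

Let norm_pic_le (y1 y2 : R -> 'cV[R]_m) (h dh : R -> R) (t : R) :
  continuous y1 -> continuous y2 -> 0 <= t ->
  0 <= h 0 -> (forall s : R, is_derive s 1 h (dh s)) ->
  (forall s, 0 <= s -> `|F (y1 s) - F (y2 s)| <= dh s) ->
  `|pic y1 t - pic y2 t| <= h t.
Proof.
move=> cy1 cy2 t0 h0 h' Fh.
have bound i : `|(pic y1 t - pic y2 t) i ord0| <= h t - h 0.
  have -> : (pic y1 t - pic y2 t) i ord0 = (pic y1 t i ord0 - pic y2 t i ord0) -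
      (pic y1 0 i ord0 - pic y2 0 i ord0) by rewrite !pic0 subrr subr0 !mxE.
  apply: (@norm_is_derive_le (fun s => pic y1 s i ord0 - pic y2 s i ord0)
    (fun s => F (y1 s) i ord0 - F (y2 s) i ord0) h dh) => // s /andP[s0 _]; last first.
    apply: le_trans (Fh _ (ltW s0)); have := cV_norm_ge (F (y1 s) - F (y2 s)) i.
    by rewrite !mxE.
  have d1 := is_derive_pic i cy1 s0; have d2 := is_derive_pic i cy2 s0.
  exact: is_deriveB.
have ht : h 0 <= h t.
  by apply: (@ge0_is_derive_le h dh) => // s /andP[s0 _]; apply: le_trans (Fh _ (ltW s0)).
by apply: cV_norm_le => [|i]; [|apply: le_trans (bound i) _]; lra.
Qed.

Let B0 : 0 <= B.
Proof. exact: le_trans (F_bnd z0). Qed.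

Let pic_lip (y : R -> 'cV[R]_m) (a b : R) : continuous y -> 0 <= a -> a <= b ->
  `|pic y b - pic y a| <= B * (b - a).
Proof.
move=> cy a0 ab; apply: cV_norm_le => [|i]; first by rewrite mulr_ge0// subr_ge0.
have -> : (pic y b - pic y a) i ord0 = pic y b i ord0 - pic y a i ord0 by rewrite !mxE.
rewrite mulrBr.
apply: (@norm_is_derive_le (fun s => pic y s i ord0)
  (fun s => F (y s) i ord0) (fun s => B * s) (fun=> B)) => // s /andP[sa _].
- by apply: is_derive_pic => //; exact: le_trans sa.
- by apply: is_derive_eq; rewrite /= ?scaler0 ?addr0 ?scaler1 /GRing.scale/=; ring.
- exact: le_trans (cV_norm_ge _ _) (F_bnd _).
Qed.

(** Truncating time at 0 extends each iterate by the constant [z0] to negative times, so it is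
    continuous on the whole line, as integration from -1 requires. *)
Let zs := fix zs (k : nat) : R -> 'cV[R]_m :=
  if k is k'.+1 then fun t => pic (zs k') (Num.max 0 t) else fun=> z0.

Let pic_max_lip (y : R -> 'cV[R]_m) (s t : R) : continuous y ->
  `|pic y (Num.max 0 s) - pic y (Num.max 0 t)| <= B * `|s - t|.
Proof.
move=> cy; wlog st : s t / s <= t => [H|].
  by case: (leP s t) => [|/ltW ts]; [exact: H|rewrite distrC (distrC s); exact: H].
rewrite distrC; apply: le_trans (pic_lip cy _ _) _.
- by rewrite le_max lexx.
- by rewrite ge_max !le_max lexx st orbT.
apply: ler_wpM2l => //; rewrite distrC ger0_norm ?subr_ge0//.
by case: (leP 0 s) => ?; case: (leP 0 t) => ?; lra.
Qed.

(** The constant [B] does not depend on [k], so the bound passes to the pointwise limit and makes it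
    continuous. *)
Let zs_lip k s t : `|zs k s - zs k t| <= B * `|s - t|.
Proof.
elim: k s t => [|k IH] s t /=; first by rewrite subrr normr0 mulr_ge0.
by apply: pic_max_lip; exact: (continuous_lipschitz IH).
Qed.

Let zs_cont k : continuous (zs k).
Proof. exact: continuous_lipschitz (zs_lip k). Qed.

(** Chosen so that the first Picard step, at most [B * t = C * (2 * L * t)], is below
    [C * growth t], by 1 + x <= e^x. *)
Let C := B / (2 * L).

Let C0 : 0 <= C.
Proof. by rewrite divr_ge0// mulr_ge0// ltW. Qed.

Let zs_step k t : 0 <= t -> `|zs k.+1 t - zs k t| <= C / 2 ^+ k * growth t.
Proof.
elim: k t => [|k IH] t t0.
  rewrite expr0 divr1 /= max_r//.
  rewrite -{2}(pic0 (fun=> z0)); apply: le_trans (pic_lip _ _ t0) _ => //.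
    by move=> s; exact: cst_continuous.
  have -> : B * (t - 0) = C * (2 * L * t) by rewrite /C; field; rewrite gt_eqF.
  rewrite ler_wpM2l// -/(growth t); apply: le_trans (expR_ge1Dx _).
  by rewrite lerDr.
have -> : zs k.+2 t - zs k.+1 t = pic (zs k.+1) t - pic (zs k) t by rewrite /= !max_r.
apply: (norm_pic_le (h := fun s => C / 2 ^+ k.+1 * growth s)
  (dh := fun s => C / 2 ^+ k.+1 * (2 * L * growth s))) => //.
- by rewrite mulr_ge0 ?growth_ge0// divr_ge0// exprn_ge0.
- move=> s s0; apply: le_trans (F_lip _ _) _.
  have -> : C / 2 ^+ k.+1 * (2 * L * growth s) = L * (C / 2 ^+ k * growth s).
    by rewrite exprS invfM; field; rewrite expf_neq0.
  by rewrite ler_pM2l// IH.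
Qed.

Lemma lipschitz_global_solution : exists z : R -> 'cV[R]_m,
  z 0 = z0 /\ forall t : R, 0 <= t -> is_derive t 1 z (F (z t)).
Proof.
have lim_ex (ti : R * 'I_m) : exists l, 0 <= ti.1 ->
    forall k, `|zs k ti.1 ti.2 ord0 - l| <= 2 * (C * growth ti.1) / 2 ^+ k.
  case: ti => t i /=; have [t0|t0] := leP 0 t; last by exists 0.
  have [k|l Hl] := @geometric_cauchy_limit (fun k => zs k t i ord0) (C * growth t).
    have := cV_norm_ge (zs k.+1 t - zs k t) i; rewrite !mxE => /le_trans; apply.
    by apply: le_trans (zs_step k t0) _; rewrite mulrAC.
  by exists l => _.
have [l Hl] := choice lim_ex.
pose zl (t : R) : 'cV[R]_m := \col_i l (Num.max 0 t, i).
have max0 t : 0 <= Num.max 0 t :> R by rewrite le_max lexx.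
have zsmax k t : zs k t = zs k (Num.max 0 t).
  by case: k => [//|k] /=; rewrite [Num.max 0 (Num.max _ _)]max_r.
have zl_near k t : `|zs k t - zl t| <= 2 * (C * growth (Num.max 0 t)) / 2 ^+ k.
  apply: cV_norm_le => [|i].
    by do ![apply: mulr_ge0 => //].
  by rewrite zsmax !mxE; exact: (Hl (Num.max 0 t, i) (max0 t) k).
have zl_lip s t : `|zl s - zl t| <= B * `|s - t|.
  rewrite -subr_le0; pose c := 2 * (C * growth (Num.max 0 s)) + 2 * (C * growth (Num.max 0 t)).
  apply: (@le0_geometric _ c) => k; rewrite /c mulrDl.
  have := zl_near k s; have := zl_near k t; have := zs_lip k s t.
  have := ler_distD (zs k s) (zl s) (zl t); have := ler_distD (zs k t) (zs k s) (zl t).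
  rewrite (distrC (zl s) (zs k s)); lra.
have zl_cont : continuous zl := continuous_lipschitz zl_lip.
have zl_pic t : 0 <= t -> pic zl t = zl t.
  move=> t0; apply/eqP; rewrite -subr_eq0 -normr_le0.
  apply: (@le0_geometric _ (2 * (C * growth t))) => k.
  have H1 : `|pic zl t - pic (zs k) t| <= C / 2 ^+ k * growth t.
    apply: (norm_pic_le (h := fun s => C / 2 ^+ k * growth s)
      (dh := fun s => C / 2 ^+ k * (2 * L * growth s))) => //.
    - by rewrite mulr_ge0 ?growth_ge0// divr_ge0// exprn_ge0.
    - move=> s s0; apply: le_trans (F_lip _ _) _.
      have -> : C / 2 ^+ k * (2 * L * growth s) = L * (2 * (C * growth s) / 2 ^+ k).
        by field; rewrite expf_neq0.
      by rewrite ler_pM2l// distrC; have := zl_near k s; rewrite max_r.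
  have H2 : `|pic (zs k) t - zl t| <= C / 2 ^+ k * growth t.
    have := zl_near k.+1 t; rewrite /= max_r//; congr (_ <= _).
    by rewrite exprS invfM; field; rewrite expf_neq0.
  have := ler_distD (pic (zs k) t) (pic zl t) (zl t).
  have -> : 2 * (C * growth t) / 2 ^+ k = C / 2 ^+ k * growth t + C / 2 ^+ k * growth t.
    by field; rewrite expf_neq0.
  lra.
(* The witness is [pic zl] and not [zl]: they agree for t >= 0, but [zl] is constant for t < 0,
   while the derivative at 0 is two-sided. *)
exists (pic zl); split; first exact: pic0.
move=> t t0; apply: is_derive_cV => i.
by rewrite zl_pic//; exact: is_derive_pic.
Qed.

End Picard.
End Ode.

(** * Lyapunov functions of Hurwitz matrices *)

Section HurwitzLyapunov.
Variable R : realType.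

Local Notation C := (complex R).
Local Notation dot u v := ((u^T *m v) ord0 ord0).

Lemma dotE n (u v : 'cV[R]_n) : dot u v = \sum_i u i ord0 * v i ord0.
Proof. by rewrite mxE; apply: eq_bigr => i _; rewrite mxE. Qed.

Lemma dotvv_ge0 n (u : 'cV[R]_n) : 0 <= dot u u.
Proof. by rewrite dotE sumr_ge0// => i _; rewrite -expr2 sqr_ge0. Qed.

Lemma dotvv_eq0 n (u : 'cV[R]_n) : dot u u = 0 -> u = 0.
Proof.
rewrite dotE => /psumr_eq0P u0; apply/colP => i; rewrite !mxE.
by apply/eqP; rewrite -sqrf_eq0 expr2 u0// => j _; rewrite -expr2 sqr_ge0.
Qed.

Lemma map_mx_ReM m n p (T : 'M[C]_(m, n)) (U : 'M[C]_(n, p)) :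
  map_mx (@complex.Re R) (T *m U) =
  map_mx (@complex.Re R) T *m map_mx (@complex.Re R) U -
  map_mx (@complex.Im R) T *m map_mx (@complex.Im R) U.
Proof.
have ReD (x y : C) : complex.Re (x + y) = complex.Re x + complex.Re y.
  by case: x y => [a b] [c d].
apply/matrixP => i j; rewrite !mxE (big_morph _ ReD (erefl _)) -sumrB.
by apply: eq_bigr => k _; rewrite !mxE; case: (T i k) (U k j) => [a b] [c d].
Qed.

Lemma map_mx_ImM m n p (T : 'M[C]_(m, n)) (U : 'M[C]_(n, p)) :
  map_mx (@complex.Im R) (T *m U) =
  map_mx (@complex.Re R) T *m map_mx (@complex.Im R) U +
  map_mx (@complex.Im R) T *m map_mx (@complex.Re R) U.
Proof.
have ImD (x y : C) : complex.Im (x + y) = complex.Im x + complex.Im y.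
  by case: x y => [a b] [c d].
apply/matrixP => i j; rewrite !mxE (big_morph _ ImD (erefl _)) -big_split.
by apply: eq_bigr => k _; rewrite !mxE; case: (T i k) (U k j) => [a b] [c d].
Qed.

(* Schur's triangularization U A = T U over R[i], written on the real and
   imaginary parts U = X + iY and T = S + iZ. *)
Lemma hurwitz_real_schur n (A : 'M[R]_n) : (0 < n)%N -> hurwitz A ->
  exists X Y S Z : 'M[R]_n,
    [/\ X *m A = S *m X - Z *m Y, Y *m A = S *m Y + Z *m X,
        forall v : 'cV[R]_n, X *m v = 0 -> Y *m v = 0 -> v = 0,
        forall i j : 'I_n, (i < j)%N -> S i j = 0 /\ Z i j = 0 &
        forall i, S i i < 0].
Proof.
move=> n0 hA; pose AC := map_mx (real_complex R) A.
have [U Uu] := Schur AC n0.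
have Uunit := unitarymx_unit Uu.
rewrite /similar_to conjumx//; set T := U *m AC *m invmx U => trigT.
have UA : U *m AC = T *m U by rewrite /T mulmxKV.
have ReA : map_mx (@complex.Re R) AC = A by apply/matrixP => i j; rewrite !mxE.
have ImA : map_mx (@complex.Im R) AC = 0 by apply/matrixP => i j; rewrite !mxE.
exists (map_mx (@complex.Re R) U), (map_mx (@complex.Im R) U),
  (map_mx (@complex.Re R) T), (map_mx (@complex.Im R) T); split.
- by have := congr1 (map_mx (@complex.Re R)) UA; rewrite !map_mx_ReM ReA ImA mulmx0 subr0.
- by have := congr1 (map_mx (@complex.Im R)) UA; rewrite !map_mx_ImM ReA ImA mulmx0 add0r.
- move=> v Xv Yv; pose vC := map_mx (real_complex R) v.
  have Rev : map_mx (@complex.Re R) vC = v by apply/matrixP => i j; rewrite !mxE.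
  have Imv : map_mx (@complex.Im R) vC = 0 by apply/matrixP => i j; rewrite !mxE.
  have UvC : U *m vC = 0.
    apply/matrixP => i j; apply/eqP; rewrite eq_complex.
    have := map_mx_ReM U vC; rewrite Rev Imv Xv mulmx0 subr0 => /matrixP/(_ i j).
    have := map_mx_ImM U vC; rewrite Rev Imv Yv mulmx0 add0r => /matrixP/(_ i j).
    by rewrite !mxE => /= -> ->; rewrite !eqxx.
  have vC0 : vC = 0 by rewrite -(mulKmx Uunit vC) UvC mulmx0.
  by rewrite -Rev vC0; apply/matrixP => i j; rewrite !mxE.
- move=> i j ij; have /is_trig_mxP T0 := trigT.
  by split; rewrite mxE (T0 _ _ ij).
- move=> i; rewrite mxE; apply: hA; rewrite -/AC.
  have -> : eigenvalue AC (T i i) = eigenvalue T (T i i).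
    apply/idP/idP => /eigenvalueP[v vA v0]; apply/eigenvalueP.
    + exists (v *m invmx U); last by rewrite mulmx_free_eq0// row_free_unit unitmx_inv.
      by rewrite /T !mulmxA mulmxKV// vA scalemxAl.
    + exists (v *m U); last by rewrite mulmx_free_eq0// row_free_unit.
      by rewrite -mulmxA UA mulmxA vA scalemxAl.
  rewrite eigenvalue_root_char char_poly_trig//; apply/rootP.
  by rewrite horner_prod (bigD1 i)//= hornerXsubC subrr mul0r.
Qed.

(** With z = u + i w, the left side is the real part of z* T z, where T = S + i Z. On the diagonal
    [Z] cancels and [S] contributes at most [- be]; off the diagonal, 2 a b <= a^2 + b^2 bounds the
    terms by [e * (N i + N j)], whose double sum is [2 * e * n%:R] times the sum of [N]. *)
Lemma lyapunov_dissipation n (A X Y S Z : 'M[R]_n) (be e : R) : 0 <= e ->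
  X *m A = S *m X - Z *m Y -> Y *m A = S *m Y + Z *m X ->
  (forall i, S i i <= - be) ->
  (forall i j, i != j -> `|S i j| <= e /\ `|Z i j| <= e) ->
  let P : 'M[R]_n := X^T *m X + Y^T *m Y in
  forall v : 'cV[R]_n, dot v (P *m (A *m v)) <= (- be + 2 * e * n%:R) * dot v (P *m v).
Proof.
move=> e0 XA YA Sd So P v; pose u := X *m v; pose w := Y *m v.
pose N i := u i ord0 ^+ 2 + w i ord0 ^+ 2.
have dotP v' : dot v (P *m v') = dot u (X *m v') + dot w (Y *m v').
  by rewrite /P mulmxDl mulmxDr mxE /u /w !trmx_mul !mulmxA.
have -> : dot v (P *m v) = \sum_i N i.
  rewrite dotP -/u -/w !dotE -big_split; apply: eq_bigr => i _ /=.
  by rewrite -!expr2.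
have -> : dot v (P *m (A *m v)) = \sum_i \sum_j
    (u i ord0 * (S i j * u j ord0 - Z i j * w j ord0) +
     w i ord0 * (S i j * w j ord0 + Z i j * u j ord0)).
  rewrite dotP (mulmxA X) (mulmxA Y) XA YA mulmxBl mulmxDl -!mulmxA -/u -/w !dotE -big_split.
  apply: eq_bigr => i _; rewrite !mxE -sumrB -big_split !mulr_sumr -big_split.
  by apply: eq_bigr.
have term i j : u i ord0 * (S i j * u j ord0 - Z i j * w j ord0) +
     w i ord0 * (S i j * w j ord0 + Z i j * u j ord0) <=
     - be * (N i *+ (i == j)) + e * (N i + N j).
  have sqr (s : R) x y : `|s| <= e -> 2 * (s * x * y) <= e * (x ^+ 2 + y ^+ 2).
    by rewrite ler_norml => /andP[? ?]; have := sqr_ge0 (x - y); have := sqr_ge0 (x + y); nra.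
  rewrite /N; have [<-|ij] := eqVneq i j.
    have := ler_wpM2r (addr_ge0 (sqr_ge0 (u i ord0)) (sqr_ge0 (w i ord0))) (Sd i).
    have := mulr_ge0 e0 (addr_ge0 (sqr_ge0 (u i ord0)) (sqr_ge0 (w i ord0))).
    rewrite mulr1n; lra.
  have [Sij Zij] := So _ _ ij.
  have NZij : `|- Z i j| <= e by rewrite normrN.
  have := sqr _ (u i ord0) (u j ord0) Sij; have := sqr _ (w i ord0) (w j ord0) Sij.
  have := sqr _ (u i ord0) (w j ord0) NZij; have := sqr _ (w i ord0) (u j ord0) Zij.
  rewrite mulr0n; lra.
apply: (@le_trans _ _ (\sum_i \sum_j (- be * (N i *+ (i == j)) + e * (N i + N j)))).
  by apply: ler_sum => i _; apply: ler_sum => j _; exact: term.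
suff -> : \sum_i \sum_j (- be * (N i *+ (i == j)) + e * (N i + N j)) =
    (- be + 2 * e * n%:R) * \sum_i N i by [].
move: N {term} => N.
under eq_bigr => i _.
  rewrite big_split/= -!mulr_sumr (bigD1 i)//= eqxx mulr1n big1 ?addr0; last first.
    by move=> j /negbTE; rewrite eq_sym => ->.
  rewrite big_split/= sumr_const card_ord.
  over.
rewrite big_split/= -!mulr_sumr big_split/= sumr_const card_ord sumrMnl.
rewrite -[_ *+ n]mulr_natr; ring.
Qed.

Lemma hurwitz_lyapunov n (A : 'M[R]_n) : (0 < n)%N -> hurwitz A ->
  exists (P : 'M[R]_n) (al : R), [/\ P^T = P, pos_definite P, 0 < al &
    forall v : 'cV[R]_n, dot v (P *m (A *m v)) <= - al * dot v (P *m v)].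
Proof.
move=> n0 hA; have [X [Y [S [Z [XA YA XY0 SZ0 Sd]]]]] := hurwitz_real_schur n0 hA.
pose be := \big[Num.min/1]_i (- S i i).
have be0 : 0 < be by apply: lt_bigmin => // i _; rewrite oppr_gt0.
have Sbe i : S i i <= - be by rewrite lerNr; exact: bigmin_le.
pose K := 1 + \sum_i \sum_j (`|S i j| + `|Z i j|).
have SZK i j : `|S i j| <= K /\ `|Z i j| <= K.
  have : `|S i j| + `|Z i j| <= K.
    rewrite /K ler_wpDl// (bigD1 i)//= (bigD1 j)//= -addrA lerDl.
    by rewrite addr_ge0// ?sumr_ge0// => k _; rewrite ?sumr_ge0// => k' _; rewrite addr_ge0.
  by have := normr_ge0 (S i j); have := normr_ge0 (Z i j); lra.
have K0 : 0 < K.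
  by rewrite ltr_wpDr// sumr_ge0// => i _; rewrite sumr_ge0// => j _; rewrite addr_ge0.
(* This makes [- be + 2 * e * n%:R] equal to [- (be / 2)]. *)
pose e := be / (4 * n%:R).
have n0R : 0 < n%:R :> R by rewrite ltr0n.
have e0 : 0 < e by rewrite divr_gt0// mulr_gt0.
(* Strictly below the diagonal [eta <= 1] gives eta^(i-j) <= eta, and [eta * K <= e] bounds the
   rescaled entries. *)
pose eta := Num.min 1 (e / K).
have eta0 : 0 < eta by rewrite lt_min ltr01 divr_gt0.
have etage0 := ltW eta0.
have eta1 : eta <= 1 by rewrite ge_min lexx.
have etaK : eta * K <= e by rewrite -ler_pdivlMr// ge_min lexx orbT.
(* Conjugation by diag (eta^i) shrinks the strictly lower triangular entries. *)
pose sc (M : 'M[R]_n) := \matrix_(i, j) (eta ^+ i * M i j).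
(* With D = diag (eta^i), this is D M D^-1 for a lower triangular [M], written without negative
   powers; the test [j <= i] guards the truncated subtraction. *)
pose tr (M : 'M[R]_n) := \matrix_(i, j) (if (j <= i)%N then eta ^+ (i - j) * M i j else 0).
have scM (M N : 'M[R]_n) : (forall i j : 'I_n, (i < j)%N -> M i j = 0) ->
    sc (M *m N) = tr M *m sc N.
  move=> M0; apply/matrixP => i j; rewrite !mxE mulr_sumr; apply: eq_bigr => k _.
  rewrite !mxE; case: leqP => [ki|/M0->]; last by rewrite !mul0r mulr0.
  by rewrite mulrACA -exprD subnK.
have scA (M N : 'M[R]_n) : sc (M *m N) = sc M *m N.
  apply/matrixP => i j; rewrite !mxE mulr_sumr; apply: eq_bigr => k _.
  by rewrite !mxE mulrA.
have scv0 (M : 'M[R]_n) (v : 'cV[R]_n) : sc M *m v = 0 -> M *m v = 0.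
  move=> /matrixP Mv; apply/matrixP => i j; have := Mv i j; rewrite !mxE.
  under eq_bigr do rewrite mxE -mulrA.
  by rewrite -mulr_sumr => /eqP; rewrite mulf_eq0 expf_eq0 gt_eqF// andbF => /eqP.
have trd (M : 'M[R]_n) i : tr M i i = M i i by rewrite mxE leqnn subnn mul1r.
have tro (M : 'M[R]_n) i j : i != j -> (forall i j, `|M i j| <= K) -> `|tr M i j| <= e.
  move=> ij MK; rewrite mxE; case: leqP => [ji|_]; last by rewrite normr0 ltW.
  rewrite normrM ger0_norm ?exprn_ge0//; apply: le_trans etaK.
  apply: ler_pM => //; first exact: exprn_ge0.
  rewrite -[leRHS]expr1 ler_wiXn2l// subn_gt0 ltn_neqAle ji andbT.
  by rewrite eq_sym -val_eqE in ij *.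
pose X' := sc X; pose Y' := sc Y.
exists (X'^T *m X' + Y'^T *m Y'), (be / 2); split.
- by rewrite linearD/= !trmx_mul !trmxK.
- move=> v v0; rewrite -mulmxA mulmxDl mulmxDr mxE -!mulmxA.
  rewrite !mulmxA -!trmx_mul -!mulmxA.
  rewrite lt_def addr_ge0 ?dotvv_ge0// andbT paddr_eq0 ?dotvv_ge0//.
  apply/negP => /andP[/eqP/dotvv_eq0 Xv /eqP/dotvv_eq0 Yv].
  by move/eqP: v0; apply; apply: XY0; apply: scv0.
- by rewrite divr_gt0.
- move=> v; apply: (le_trans (@lyapunov_dissipation n A X' Y' (tr S) (tr Z) be e _ _ _ _ _ v)).
  + exact: ltW.
  + rewrite -scA XA /X' /Y' -!scM => [|i j /SZ0[]//|i j /SZ0[]//].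
    by apply/matrixP => i j; rewrite !mxE mulrBr.
  + rewrite -scA YA /X' /Y' -!scM => [|i j /SZ0[]//|i j /SZ0[]//].
    by apply/matrixP => i j; rewrite !mxE mulrDr.
  + by move=> i; rewrite trd.
  + by move=> i j ij; split; apply: tro => // k l; have [] := SZK k l.
  + have -> : - be + 2 * e * n%:R = - (be / 2) by rewrite /e; field; rewrite gt_eqF.
    by [].
Qed.
End HurwitzLyapunov.

(** * Second-order expansions *)

Section QuadraticForms.
Variable R : realType.

Local Notation dot u v := ((u^T *m v) ord0 ord0).

Lemma bilinear_form_bound (m : nat) (M : 'M[R]_m) :
  exists2 K, 0 < K & forall u v : 'cV[R]_m, `|dot u (M *m v)| <= K * `|u| * `|v|.
Proof.
exists (1 + \sum_i \sum_j `|M i j|).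
  by rewrite ltr_wpDr// sumr_ge0// => i _; exact: sumr_ge0.
move=> u v; apply: (@le_trans _ _ ((\sum_i \sum_j `|M i j|) * (`|u| * `|v|))); last first.
  by rewrite -mulrA ler_wpM2r ?mulr_ge0// lerDr.
rewrite dotE mulr_suml; apply: le_trans (ler_norm_sum _ _ _) _.
apply: ler_sum => i _; rewrite mxE mulr_sumr mulr_suml.
apply: le_trans (ler_norm_sum _ _ _) _; apply: ler_sum => j _.
rewrite !normrM mulrCA ler_wpM2l// ler_pM ?cV_norm_ge//.
Qed.

(** The constant is the minimum of the quadratic form on the unit sphere, attained by compactness.
    The sphere is taken in row vectors, to which [EVT_min_rV] applies; homogeneity carries the bound
    to all vectors. *)
Lemma pos_definite_coercive (m : nat) (M : 'M[R]_m) : pos_definite M ->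
  exists2 c, 0 < c & forall v : 'cV[R]_m, c * `|v| ^+ 2 <= dot v (M *m v).
Proof.
move=> Mpos; pose f (r : 'rV[R]_m) : R := (r *m M *m r^T) ord0 ord0.
have normT (v : 'cV[R]_m) : `|v| <= `|v^T|.
  apply: cV_norm_le => // i; rewrite [leRHS]/Num.Def.normr/= mx_normrE.
  by have := le_bigmax 0 (fun ij => `|v^T ij.1 ij.2|) (ord0, i); rewrite /= mxE.
pose S := [set r : 'rV[R]_m | `|r| = 1].
have scaled c : (forall r, S r -> c <= f r) -> 0 <= c ->
    forall v : 'cV[R]_m, c * `|v| ^+ 2 <= dot v (M *m v).
  move=> cS c0 v; apply: (@le_trans _ _ (c * `|v^T| ^+ 2)).
    by rewrite ler_wpM2l// lerXn2r ?nnegrE.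
  have [v0|v0] := eqVneq v 0.
    by rewrite v0 mulmx0 mulmx0 mxE trmx0 normr0 expr0n mulr0.
  have vT0 : 0 < `|v^T| by rewrite normr_gt0 -(inj_eq (@trmx_inj _ _ _)) trmxK trmx0.
  rewrite -ler_pdivlMr ?exprn_gt0//.
  have := cS (`|v^T|^-1 *: v^T) _; rewrite /S/= normrZ normfV normr_id mulVf ?gt_eqF//.
  move=> /(_ erefl); rewrite /f linearZ/= -scalemxAl -scalemxAl -scalemxAr scalerA trmxK mxE.
  by rewrite mulmxA [leRHS]mulrC -exprVn expr2.
(* The sphere is empty exactly when [m] is 0. *)
have [S0|/set0P Sn0] := eqVneq S set0.
  by exists 1 => //; apply: scaled => // r; rewrite S0.
have rowM_cont j : continuous (fun r : 'rV[R]_m => \sum_i r ord0 i * M i j).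
  apply: continuous_big => [|i _ r]; first exact: add_continuous.
  apply: (@continuousM R _ (fun r : 'rV[R]_m => r ord0 i) (cst (M i j)) r).
    exact: coord_continuous.
  exact: cst_continuous.
have fcont : continuous f.
  rewrite /f [X in continuous X](_ : _ = fun r : 'rV[R]_m =>
    \sum_j (\sum_i r ord0 i * M i j) * r ord0 j); last first.
    by apply/funext => r; rewrite mxE; apply: eq_bigr => j _; rewrite !mxE.
  apply: continuous_big => [|j _ r]; first exact: add_continuous.
  apply: (@continuousM R _ (fun r : 'rV[R]_m => \sum_i r ord0 i * M i j)
    (fun r : 'rV[R]_m => r ord0 j) r).
    exact: rowM_cont.
  exact: coord_continuous.
have Scpt : compact S.
  apply: bounded_closed_compact.
    by exists 1; split=> // x x1 r; rewrite /S/= => ->; exact: ltW.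
  rewrite [S](_ : _ = (fun r : 'rV[R]_m => `|r|) @^-1` [set 1])//.
  by apply: closed_comp => [r _|]; [exact: norm_continuous|exact: closed_eq].
have [r0 r0S r0min] := EVT_min_rV Sn0 Scpt (continuous_subspaceT fcont).
have fr0 : 0 < f r0.
  have := Mpos r0^T; rewrite trmxK; apply.
  apply/eqP => /(congr1 trmx); rewrite trmxK trmx0 => r00.
  by move: r0S; rewrite inE /S/= r00 normr0 => /eqP; rewrite eq_sym oner_eq0.
exists (f r0) => //; apply: scaled => [r Sr|]; last exact: ltW.
by apply: r0min; rewrite inE.
Qed.

End QuadraticForms.

Section Differentials.
Variable R : realType.

Lemma differentiable_expansion (V W : normedModType R) (h : V -> W) (z0 : V) (e : R) :
  differentiable h z0 -> 0 < e ->
  exists2 d, 0 < d & forall z, `|z| < d -> `|h (z + z0) - h z0 - 'd h z0 z| <= e * `|z|.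
Proof.
move=> /diff_locallyP[_ /eqaddoP dh] e0.
have /nbhs_ballP[d /= d0 dball] := dh e e0.
exists d => // z zd; have := dball z; rewrite -ball_normE/= sub0r normrN => /(_ zd).
by rewrite /= !fctE/= opprD addrA.
Qed.


Lemma cV_sum_delta (m : nat) (z : 'cV[R]_m) : z = \sum_i z i ord0 *: delta_mx i ord0.
Proof. by rewrite {1}[z]matrix_sum_delta; apply: eq_bigr => i _; rewrite big_ord1. Qed.

Lemma diff_gradient (m : nat) (h : 'cV[R]_m -> R) (w z : 'cV[R]_m) :
  differentiable h w -> 'd h w z = (z^T *m gradient h w) ord0 ord0.
Proof.
move=> dh; rewrite {1}[z]cV_sum_delta linear_sum dotE; apply: eq_bigr => i _.
by rewrite linearZ/= -deriveE// mxE.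
Qed.

Lemma diff_hessian (m : nat) (h : 'cV[R]_m -> R) (w z : 'cV[R]_m) :
  differentiable (gradient h) w -> 'd (gradient h) w z = hessian h w *m z.
Proof.
move=> dg; rewrite {1}[z]cV_sum_delta linear_sum; apply/matrixP => i j.
rewrite (ord1 j) summxE mxE; apply: eq_bigr => k _.
rewrite linearZ/= -deriveE// derive_mx; last exact: diff_derivable.
have gE : (fun t => gradient h t i ord0) = partial h i by apply/funext => t; rewrite mxE.
by rewrite mxE [X in _ * X]mxE gE [hessian _ _ _ _]mxE mulrC.
Qed.

(** The gradient is differentiable at 0 only, so no second derivative is used along the segment.
    Instead, the derivative of h(t z) - t^2 Q / 2 is z^T (gradient h (t z) - H t z), which the
    first-order expansion of the gradient bounds by e |z|^2; integrate over [0, 1]. *)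
Lemma taylor2 (m : nat) (h : 'cV[R]_m -> R) (e : R) :
  h 0 = 0 -> gradient h 0 = 0 -> twice_differentiable_at h 0 -> 0 < e ->
  exists2 d, 0 < d & forall z, `|z| < d ->
    `|h z - 2^-1 * (z^T *m (hessian h 0 *m z)) ord0 ord0| <= e * `|z| ^+ 2.
Proof.
move=> h0 gh0 [/nbhs_ballP[d1 /= d10 dh] dgh] e0.
(* The norm is the maximum norm, so bounding a dot product by norms costs a factor [K], which
   [e / K] compensates. *)
have [K K0 Kb] := bilinear_form_bound (1%:M : 'M[R]_m).
have eK : 0 < e / K by rewrite divr_gt0.
have [d2 d20 gh] := differentiable_expansion dgh eK.
exists (Num.min d1 d2); first by rewrite lt_min d10.
move=> z; rewrite lt_min => /andP[zd1 zd2].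
set Q := (z^T *m (hessian h 0 *m z)) ord0 ord0.
have small (t : R) : 0 <= t <= 1 -> `|t *: z| <= `|z|.
  by move=> /andP[t0 t1]; rewrite normrZ ger0_norm// ler_piMl.
have dphi (t : R) : 0 <= t <= 1 -> is_derive t 1 (fun s => h (s *: z) - s ^+ 2 * (2^-1 * Q))
    ((z^T *m gradient h (t *: z)) ord0 ord0 - t * Q).
  move=> t01; have dhz : differentiable h (t *: z).
    by apply: dh; rewrite -ball_normE/= sub0r normrN (le_lt_trans (small t t01)).
  have d1h : is_derive t 1 (fun s => h (s *: z)) ((z^T *m gradient h (t *: z)) ord0 ord0).
    have shift_eq : (fun e : R => e^-1 *: (h ((e *: 1 + t) *: z) - h (t *: z))) =
        (fun e => e^-1 *: (h (e *: z + t *: z) - h (t *: z))).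
      by apply/funext => s; rewrite scalerDl [s *: 1]mulr1.
    apply: DeriveDef; rewrite /derivable /derive /= shift_eq.
      exact: diff_derivable.
    by rewrite -diff_gradient// -deriveE.
  by apply: is_derive_eq; rewrite /= /GRing.scale/=; field.
have := @norm_is_derive_le R _ _ (fun s => e * `|z| ^+ 2 * s) (fun=> e * `|z| ^+ 2) 0 1 ler01 dphi.
rewrite scale1r scale0r h0 expr1n expr0n/= mul1r mul0r !subr0 mulr1 mulr0 subr0; apply.
  by move=> t _; apply: is_derive_eq; rewrite /= /GRing.scale/=; ring.
move=> t /andP[t0 t1]; have t01 : 0 <= t <= 1 by rewrite !ltW.
have zt := gh (t *: z) (le_lt_trans (small t t01) zd2).
rewrite addr0 gh0 subr0 diff_hessian// in zt.
have -> : (z^T *m gradient h (t *: z)) ord0 ord0 - t * Q =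
    (z^T *m (1%:M *m (gradient h (t *: z) - hessian h 0 *m (t *: z)))) ord0 ord0.
  have subE (X Y : 'M[R]_1) : (X - t *: Y) ord0 ord0 = X ord0 ord0 - t * Y ord0 ord0.
    by rewrite !mxE.
  by rewrite mul1mx mulmxBr -scalemxAr -scalemxAr subE.
apply: le_trans (Kb _ _) _; rewrite mulrAC expr2 mulrA ler_wpM2r//.
rewrite -ler_pdivlMl//; apply: le_trans zt _.
by rewrite mulrA [K^-1 * e]mulrC ler_wpM2l ?small// ltW.
Qed.

(** Translates the hypotheses on the slices through 0 into the differential of [joint h]: the slice
    in x is [joint h] composed with the linear embedding [M], and the slice in lambda follows the
    last basis vector [e]. *)
Lemma diff_joint (n : nat) (W : normedModType R) (h : 'cV[R]_n -> R -> W) :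
  differentiable (joint h) (0 : 'cV[R]_(n + 1)) -> forall z,
  'd (joint h) 0 z =
    'd (fun x => h x 0) 0 (usubmx z) + lam_part z *: derive1 (fun l => h 0 l) 0.
Proof.
move=> dh z; pose M : 'M[R]_(n + 1, n) := col_mx 1%:M 0.
have ME (x : 'cV[R]_n) : M *m x = col_mx x 0 by rewrite mul_col_mx mul1mx mul0mx.
have jME (x : 'cV[R]_n) : joint h (M *m x) = h x 0.
  by rewrite ME /joint /lam_part col_mxKu col_mxEd mxE.
have hE : (fun x => h x 0) = joint h \o mulmx M by apply/funext => x; rewrite /= jME.
have dM : differentiable (mulmx M) (0 : 'cV[R]_n).
  apply: linear_differentiable; apply: (@continuous_lipschitz _ _ _ _ 1) => v w.
  rewrite mul1r -mulmxBr ME; apply: cV_norm_le => // i.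
  by rewrite mxE; case: splitP => j _; [exact: cV_norm_ge|rewrite mxE normr0].
have dslice : differentiable (fun x => h x 0) (0 : 'cV[R]_n).
  by rewrite hE; apply: (differentiable_comp dM); rewrite mulmx0.
pose e := col_mx (0 : 'cV[R]_n) (1%:M : 'M[R]_1).
have zE : z = M *m usubmx z + lam_part z *: e.
  rewrite -{1}[z]vsubmxK ME scale_col_mx add_col_mx scaler0 addr0 add0r; congr col_mx.
  by apply/matrixP => i j; rewrite (ord1 i) (ord1 j) !mxE mulr1; congr (z _ _); apply/val_inj.
rewrite {1}zE linearD linearZ/=; congr (_ + _ *: _).
- rewrite -!deriveE// /derive /=.
  rewrite [X in X @ _](_ : _ = (fun s : R =>
    s^-1 *: (h (s *: usubmx z + 0) 0 - h 0 0)))//.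
  apply/funext => s.
  by rewrite !addr0 scalemxAr jME -[in joint h 0](mulmx0 _ M) jME.
- rewrite -deriveE// derive1E /derive /=.
  have jE (l : R) : joint h (l *: e) = h 0 l.
    by rewrite /joint /lam_part scale_col_mx scaler0 col_mxKu col_mxEd !mxE mulr1.
  rewrite [X in X @ _](_ : _ = (fun s : R => s^-1 *: (h 0 (s *: 1 + 0) - h 0 0)))//.
  apply/funext => s.
  by rewrite !addr0 jE [s *: 1]mulr1 -[in joint h 0](scale0r e) jE.
Qed.

End Differentials.

(** * Invariance of the half-cone *)

Section RealCurves.
Variable R : realType.

(** u(t) e^(D t) is nonincreasing. The inequality on the open interval suffices for the strict sign
    at [T], which is what reaching the end of an interval of invariance needs. *)
Lemma gronwall_lt0 (u du : R -> R) (D T : R) : 0 <= T ->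
  (forall t, 0 <= t <= T -> is_derive t 1 u (du t)) ->
  (forall t, 0 < t < T -> du t <= - D * u t) -> u 0 < 0 -> u T < 0.
Proof.
move=> T0 u' duD u0.
have E' (t : R) : is_derive t 1 (fun s => expR (D * s)) (expR (D * t) * D).
  have d1 : is_derive t 1 (fun s : R => D * s) D.
    by apply: is_derive_eq; rewrite /= /GRing.scale/=; ring.
  exact: (@is_derive1_comp _ expR (fun s => D * s)).
have := @ge0_is_derive_le R (fun s => - (u s * expR (D * s)))
  (fun s => expR (D * s) * (- du s - D * u s)) 0 T T0.
rewrite mulr0 expR0 mulr1 lerN2 => mono.
rewrite -(pmulr_llt0 (u T) (expR_gt0 (D * T))); apply: le_lt_trans u0; apply: mono => t tT.
  have d1 := u' t tT; have d2 := E' t.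
  by apply: is_derive_eq; rewrite /= /GRing.scale/=; ring.
by rewrite mulr_ge0 ?expR_ge0//; have := duD t tT; lra.
Qed.

(** If [Q] failed somewhere, it would hold at the infimum of the failure times by the closedness
    step, and the openness step would then leave no failure just after it. *)
Lemma real_continuous_induction (Q : R -> Prop) : Q 0 ->
  (forall T, 0 < T -> (forall s, 0 <= s < T -> Q s) -> Q T) ->
  (forall T, 0 <= T -> Q T -> exists2 e, 0 < e & forall s, T <= s < T + e -> Q s) ->
  forall t, 0 <= t -> Q t.
Proof.
move=> Q0 Qclosed Qopen t t0; apply: contrapT => nQt.
pose E : set R := [set s | 0 <= s /\ ~ Q s].
have Einf : has_inf E by split; [exists t|exists 0 => s []].
have T0 : 0 <= inf E by apply: lb_le_inf => [|s []//]; exists t.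
have below s : 0 <= s < inf E -> Q s.
  move=> /andP[s0 sT]; apply: contrapT => nQs.
  by move: sT; rewrite ltNge ge_inf//; exists 0 => r [].
have QT : Q (inf E).
  by move: T0; rewrite le_eqVlt => /predU1P[<-//|T0]; exact: Qclosed.
have [e e0 Qe] := Qopen _ T0 QT.
have [s [s0 nQs] sT] := inf_adherent e0 Einf.
by apply: (nQs); apply: Qe; rewrite sT andbT; apply: ge_inf; [exists 0 => r []|split].
Qed.

Lemma is_derive_continuous (V : normedModType R) (u : R -> V) (t : R) (du : V) :
  is_derive t 1 u du -> {for t, continuous u}.
Proof. by case=> du' _; apply/differentiable_continuous/derivable1_diffP. Qed.

Lemma is_derive_mulmx (m p : nat) (M : 'M[R]_(p, m)) (u : R -> 'cV[R]_m) (t : R) du :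
  is_derive t 1 u du -> is_derive t 1 (fun s => M *m u s) (M *m du).
Proof.
move=> u'; apply: is_derive_cV => i.
rewrite mxE [X in is_derive _ _ X _](_ : _ = \sum_j (fun s => M i j * u s j ord0)); last first.
  by apply/funext => s; rewrite mxE fct_sumE.
apply: is_derive_sum => j; have := is_derive_cV_coord j u' => d1.
by apply: is_derive_eq; rewrite /= /GRing.scale/=; ring.
Qed.

Lemma is_derive_dot (m : nat) (u v : R -> 'cV[R]_m) (t : R) du dv :
  is_derive t 1 u du -> is_derive t 1 v dv ->
  is_derive t 1 (fun s => ((u s)^T *m v s) ord0 ord0)
    ((du^T *m v t) ord0 ord0 + ((u t)^T *m dv) ord0 ord0).
Proof.
move=> u' v'; rewrite !dotE -big_split/=.
rewrite [X in is_derive _ _ X _](_ : _ = \sum_j (fun s => u s j ord0 * v s j ord0)); last first.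
  by apply/funext => s; rewrite dotE fct_sumE.
apply: is_derive_sum => j.
have d1 := is_derive_cV_coord j u'; have d2 := is_derive_cV_coord j v'.
by apply: is_derive_eq; rewrite /= /GRing.scale/=; ring.
Qed.

(** Retraction onto the closed ball of radius [r] of the maximum norm (for [0 <= r]). Being
    1-Lipschitz in that norm, it turns a field Lipschitz on the ball into a global one. *)
Definition cV_clamp (m : nat) (r : R) (z : 'cV[R]_m) : 'cV[R]_m :=
  \col_i Num.max (- r) (Num.min r (z i ord0)).

Lemma cV_clamp_norm (m : nat) (r : R) (z : 'cV[R]_m) : 0 <= r -> `|cV_clamp r z| <= r.
Proof.
move=> r0; apply: cV_norm_le => // i; rewrite mxE ler_norml le_max lexx/=.
by rewrite ge_max ge_min lexx andbT/=; lra.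
Qed.

Lemma cV_clamp_id (m : nat) (r : R) (z : 'cV[R]_m) : `|z| <= r -> cV_clamp r z = z.
Proof.
move=> zr; apply/matrixP => i j; rewrite (ord1 j) mxE.
have := le_trans (cV_norm_ge z i) zr; rewrite ler_norml => /andP[? ?].
by rewrite min_r// max_r.
Qed.

Lemma cV_clamp_lip (m : nat) (r : R) (z w : 'cV[R]_m) : 0 <= r ->
  `|cV_clamp r z - cV_clamp r w| <= `|z - w|.
Proof.
move=> r0; apply: cV_norm_le => // i; apply: le_trans (cV_norm_ge (z - w) i).
rewrite !mxE; move: (z i ord0) (w i ord0) => a b.
wlog ab : a b / a <= b => [H|].
  by case: (leP a b) => [|/ltW ba]; [exact: H|rewrite distrC (distrC a); exact: H].
rewrite [leRHS]distrC (ger0_norm (_ : 0 <= b - a)) ?subr_ge0// ler_norml.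
apply/andP; split; case: (leP r a) => ?; case: (leP r b) => ?;
  rewrite ?[Num.max (- r) r]max_r; do ?[by lra];
  case: (leP (- r) a) => ?; case: (leP (- r) b) => ?; lra.
Qed.

End RealCurves.

Section ConeDynamics.
Variables (R : realType) (n : nat).
Variables (f : 'cV[R]_n -> R -> 'cV[R]_n) (g : 'cV[R]_n -> R -> R).
Variables (A P : 'M[R]_n) (b q : 'cV[R]_n).
Variables (s al K M e cg Cg r L d : R).

Local Notation dot u v := ((u^T *m v) ord0 ord0).
Local Notation V y := (dot y (P *m y)).

Hypothesis s2 : s * s = 1.
Hypothesis Aq : A *m q = b.
Hypothesis Psym : P^T = P.
Hypothesis dissip : forall v : 'cV[R]_n, dot v (P *m (A *m v)) <= - al * V v.
Hypothesis K0 : 0 < K.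
Hypothesis PK : forall u v : 'cV[R]_n, `|dot u (P *m v)| <= K * `|u| * `|v|.
Hypothesis M0 : 0 < M.
Hypothesis PM : forall v : 'cV[R]_n, `|v| ^+ 2 <= M ^+ 2 * V v.
(** On the cone |x| <= |y| + |l| |q| <= (M + |q|) |l|; the last 1 accounts for the coordinate l,
    giving |z| <= N |l|. *)
Let N := M + `|q| + 1.
Hypothesis e0 : 0 < e.
Hypothesis f_lin : forall z : 'cV[R]_(n + 1), `|z| <= r ->
  `|joint f z - (A *m usubmx z + lam_part z *: b)| <= e * `|z|.
Hypothesis cg0 : 0 < cg.
Hypothesis g_ge : forall z : 'cV[R]_(n + 1), `|z| <= r -> cg * `|z| ^+ 2 <= s * joint g z.
Hypothesis Cg0 : 0 < Cg.
Hypothesis g_le : forall z : 'cV[R]_(n + 1), `|z| <= r -> s * joint g z <= Cg * `|z| ^+ 2.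
Hypothesis r0 : 0 < r.
Hypothesis L0 : 0 < L.
Hypothesis f_lip : forall z w : 'cV[R]_(n + 1), `|z| <= r -> `|w| <= r ->
  `|joint f z - joint f w| <= L * `|z - w|.
Hypothesis g_lip : forall z w : 'cV[R]_(n + 1), `|z| <= r -> `|w| <= r ->
  `|joint g z - joint g w| <= L * `|z - w|.
Hypothesis d0 : 0 < d.
Hypothesis Nd : N * d <= r.
(** The errors in W' / 2, divided by l^2: the linear remainder of [f], the motion [g q] of the
    shear, and the shrinking of l^2. *)
Hypothesis small : K * M * (e * N + Cg * N ^+ 2 * `|q| * d) + Cg * N ^+ 2 * d <= al.

(* On the slow manifold, approximately x = - l q, the sheared coordinate
   y = x + l q vanishes. *)
Let shear (z : 'cV[R]_(n + 1)) : 'cV[R]_n := usubmx z + lam_part z *: q.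

(* The half of {V(y) < l^2} on which the flow pushes l towards 0. *)
Definition cone : set 'cV[R]_(n + 1) :=
  [set z | [/\ s * lam_part z < 0, - d < s * lam_part z &
            V (shear z) < lam_part z ^+ 2]].

Let N0 : 0 < N.
Proof. by rewrite /N ltr_wpDl// addr_ge0// ltW. Qed.

Let norms : `|s| = 1.
Proof. by apply/eqP; rewrite -(@eqrXn2 _ 2) ?expr1n// -normrX expr2 s2 normr1. Qed.

Let absl z : cone z -> `|lam_part z| = - (s * lam_part z).
Proof.
by case=> sl _ _; rewrite -(ltr0_norm sl) normrM norms mul1r.
Qed.

Let lam_le_norm (z : 'cV[R]_(n + 1)) : `|lam_part z| <= `|z|.
Proof. exact: cV_norm_ge. Qed.

Let sqr_lam (z : 'cV[R]_(n + 1)) : `|lam_part z| ^+ 2 = lam_part z ^+ 2.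
Proof. by rewrite real_normK// num_real. Qed.

Let cone_shear z : cone z -> `|shear z| <= M * `|lam_part z|.
Proof.
move=> [_ _ Vz]; rewrite -(@ler_pXn2r _ 2)// ?nnegrE ?mulr_ge0 ?(ltW M0)//.
rewrite exprMn sqr_lam; apply: le_trans (PM _) _.
by rewrite ler_wpM2l ?sqr_ge0// ltW.
Qed.

Let cone_norm z : cone z -> `|z| <= N * `|lam_part z|.
Proof.
move=> cz; have yz := cone_shear cz; have l0 := normr_ge0 (lam_part z).
have q0 := normr_ge0 q.
have xz : `|usubmx z| <= (M + `|q|) * `|lam_part z|.
  have -> : usubmx z = shear z - lam_part z *: q by rewrite /shear addrK.
  by apply: le_trans (ler_normB _ _) _; rewrite normrZ mulrDl [`|q| * _]mulrC lerD2r.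
have Ml0 : 0 <= (M + `|q|) * `|lam_part z| by rewrite mulr_ge0// addr_ge0// ltW.
apply: cV_norm_le => [|i]; first by rewrite mulr_ge0// ltW.
rewrite /N mulrDl mul1r -[z]vsubmxK mxE.
case: splitP => j ij.
  by apply: (@le_trans _ _ `|usubmx z|); [exact: cV_norm_ge|rewrite vsubmxK; lra].
rewrite (ord1 j) mxE vsubmxK.
by rewrite -[X in `|X| <= _]/(lam_part z); lra.
Qed.

Let cone_lam z : cone z -> `|lam_part z| < d.
Proof. by move=> cz; rewrite absl//; case: cz => _ ? _; lra. Qed.

Let cone_r z : cone z -> `|z| <= r.
Proof.
move=> cz; apply: le_trans (cone_norm cz) _; apply: le_trans Nd.
by rewrite ler_pM2l// ltW// cone_lam.
Qed.

Let cone_g_ge z : cone z -> cg * lam_part z ^+ 2 <= s * joint g z.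
Proof.
move=> cz; apply: le_trans (g_ge (cone_r cz)); rewrite ler_pM2l// -sqr_lam.
by rewrite ler_sqr ?nnegrE.
Qed.

Let cone_g_le z : cone z -> s * joint g z <= Cg * N ^+ 2 * lam_part z ^+ 2.
Proof.
move=> cz; apply: le_trans (g_le (cone_r cz)) _; rewrite -mulrA ler_pM2l//.
rewrite -sqr_lam -exprMn; apply: lerXn2r; rewrite ?nnegrE//; last exact: cone_norm.
by rewrite mulr_ge0// ltW.
Qed.

(** The left side is W'. As [A *m q = b], the sheared field is A y plus the remainder [rho] and g q.
    Since s l < 0 <= s g, the term - 2 l g equals 2 |l| |g|, a growth term; all errors together stay
    below the reserve 2 al l^2. *)
Let cone_dV z : cone z ->
  2 * dot (shear z) (P *m (joint f z + joint g z *: q)) - 2 * lam_part z * joint g z <=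
  - (2 * al) * (V (shear z) - lam_part z ^+ 2).
Proof.
move=> cz; set y := shear z; set l := lam_part z; set gz := joint g z.
pose rho := joint f z - (A *m usubmx z + l *: b).
have fE : joint f z + gz *: q = A *m y + (rho + gz *: q).
  rewrite /y /shear mulmxDr -scalemxAr Aq.
  by rewrite [RHS]addrA [X in _ = X + _]addrC /rho subrK.
have rhoz : `|rho| <= e * (N * `|l|).
  by apply: le_trans (f_lin (cone_r cz)) _; rewrite ler_pM2l// cone_norm.
have l0 := normr_ge0 l.
have gabs : `|gz| = s * gz.
  have sgz : 0 <= s * gz by apply: le_trans (cone_g_ge cz); rewrite mulr_ge0 ?sqr_ge0// ltW.
  by rewrite -(ger0_norm sgz) normrM norms mul1r.
have gzl : `|gz| <= Cg * N ^+ 2 * `|l| ^+ 2 by rewrite gabs sqr_lam; exact: cone_g_le.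
have lgz : - (l * gz) = `|l| * `|gz|.
  have : s * l * (s * gz) = l * gz by rewrite mulrACA s2 mul1r.
  by rewrite gabs (absl cz) -/l => <-; rewrite mulNr.
have ld : `|l| <= d by rewrite ltW// cone_lam.
have h1 : `|dot y (P *m (rho + gz *: q))| <=
    K * (M * `|l|) * (e * (N * `|l|) + Cg * N ^+ 2 * `|l| ^+ 2 * `|q|).
  apply: le_trans (PK _ _) _; apply: ler_pM => //.
  - by rewrite mulr_ge0// ltW.
  - by rewrite ler_pM2l// cone_shear.
  - apply: le_trans (ler_normD _ _) _; rewrite lerD// normrZ.
    by rewrite ler_wpM2r.
rewrite fE mulmxDr mulmxDr mxE.
have h2 := dissip y; have h3 := ler_norm (dot y (P *m (rho + gz *: q))).
suff h4 : K * (M * `|l|) * (e * (N * `|l|) + Cg * N ^+ 2 * `|l| ^+ 2 * `|q|) +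
    `|l| * (Cg * N ^+ 2 * `|l| ^+ 2) <= al * l ^+ 2.
  have h5 : `|l| * `|gz| <= `|l| * (Cg * N ^+ 2 * `|l| ^+ 2) by rewrite ler_wpM2l.
  by move: h1 h2 h3 h4 h5 lgz; rewrite -/y; lra.
rewrite -(sqr_lam z) -/l.
have -> : K * (M * `|l|) * (e * (N * `|l|) + Cg * N ^+ 2 * `|l| ^+ 2 * `|q|) +
    `|l| * (Cg * N ^+ 2 * `|l| ^+ 2) =
    (K * M * (e * N + Cg * N ^+ 2 * `|q| * `|l|) + Cg * N ^+ 2 * `|l|) * `|l| ^+ 2 by ring.
rewrite ler_wpM2r ?sqr_ge0//; apply: le_trans small.
have CN : 0 <= Cg * N ^+ 2 by rewrite mulr_ge0 ?sqr_ge0// ltW.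
rewrite lerD ?ler_wpM2l ?lerD2l ?mulr_ge0 ?ler_wpM2l// ?mulr_ge0// ltW//.
Qed.


Let Phi (z : 'cV[R]_(n + 1)) : 'cV[R]_(n + 1) :=
  col_mx (joint f z) (const_mx (joint g z) : 'cV[R]_1).

Let usubPhi z : usubmx (Phi z) = joint f z.
Proof. exact: col_mxKu. Qed.

Let lamPhi z : lam_part (Phi z) = joint g z.
Proof. by rewrite /lam_part /Phi col_mxEd mxE. Qed.

Let Phi_lip z w : `|z| <= r -> `|w| <= r -> `|Phi z - Phi w| <= L * `|z - w|.
Proof.
move=> zr wr; have fl := f_lip zr wr; have gl := g_lip zr wr.
apply: cV_norm_le => [|i]; first by rewrite mulr_ge0// ltW.
rewrite /Phi opp_col_mx add_col_mx mxE; case: splitP => j _.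
  by apply: le_trans fl; exact: cV_norm_ge.
by rewrite !mxE.
Qed.

Let usub_norm (z : 'cV[R]_(n + 1)) : `|usubmx z| <= `|z|.
Proof. by apply: cV_norm_le => // i; rewrite mxE; exact: cV_norm_ge. Qed.

Let is_derive_usub (z : R -> 'cV[R]_(n + 1)) (t : R) dz :
  is_derive t 1 z dz -> is_derive t 1 (fun s => usubmx (z s)) (usubmx dz).
Proof.
move=> z'; apply: is_derive_cV => i; have := is_derive_cV_coord (lshift 1 i) z'.
rewrite mxE; congr (is_derive _ _ _ _).
by apply/funext => u; rewrite mxE.
Qed.

Let is_derive_lam (z : R -> 'cV[R]_(n + 1)) (t : R) dz :
  is_derive t 1 z dz -> is_derive t 1 (fun s => lam_part (z s)) (lam_part dz).
Proof. by move=> z'; exact: is_derive_cV_coord. Qed.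

Let is_derive_shear (z : R -> 'cV[R]_(n + 1)) (t : R) dz :
  is_derive t 1 z dz -> is_derive t 1 (fun s => shear (z s)) (shear dz).
Proof.
move=> z'; apply: is_derive_cV => i.
have d1 := is_derive_cV_coord i (is_derive_usub z'); have d2 := is_derive_lam z'.
have d3 := is_deriveM d2 (is_derive_cst (q i ord0) t 1).
rewrite [X in is_derive _ _ X _](_ : _ = (fun s => usubmx (z s) i ord0) +
  (fun s => lam_part (z s)) * cst (q i ord0)).
  apply: is_derive_eq (is_deriveD d1 d3) _.
  rewrite scaler0 add0r /GRing.scale/= /shear [RHS]mxE [X in _ = _ + X]mxE.
  by rewrite [X in _ + X]mulrC.
by apply/funext => u; rewrite !fctE /shear mxE [X in _ + X]mxE.
Qed.

Let is_derive_W (z : R -> 'cV[R]_(n + 1)) (t : R) dz : is_derive t 1 z dz ->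
  is_derive t 1 (fun s => V (shear (z s)) - lam_part (z s) ^+ 2)
    (2 * dot (shear (z t)) (P *m shear dz) - 2 * lam_part (z t) * lam_part dz).
Proof.
move=> z'; have d1 := is_derive_shear z'; have d2 := is_derive_lam z'.
have d3 := is_derive_dot d1 (is_derive_mulmx P d1).
have sym : dot (shear dz) (P *m shear (z t)) = dot (shear (z t)) (P *m shear dz).
  have tr1 (X : 'M[R]_1) : X ord0 ord0 = X^T ord0 ord0 by rewrite mxE.
  by rewrite [LHS]tr1 !trmx_mul trmxK Psym mulmxA.
rewrite sym in d3.
apply: is_derive_eq (is_deriveB d3 (is_deriveX 2 d2)) _.
by rewrite /GRing.scale/=; ring.
Qed.

Lemma cone_basin : cone `<=` basin f g 0 0.
Proof.
move=> z0 z0cone; pose F z := Phi (cV_clamp r z).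
have r0' := ltW r0.
have F_lip z w : `|F z - F w| <= L * `|z - w|.
  apply: le_trans (Phi_lip (cV_clamp_norm _ r0') (cV_clamp_norm _ r0')) _.
  by rewrite ler_pM2l// cV_clamp_lip.
have F_bnd z : `|F z| <= `|Phi 0| + L * r.
  rewrite -(subrK (Phi 0) (F z)) addrC; apply: le_trans (ler_normD _ _) _.
  rewrite lerD2l; apply: le_trans (Phi_lip (cV_clamp_norm _ r0') _) _; first by rewrite normr0.
  by rewrite subr0 ler_pM2l// cV_clamp_norm.
have [z [z00 z']] := lipschitz_global_solution z0 L0 F_lip F_bnd.
pose l t := lam_part (z t); pose mu t := s * l t.
pose W t := V (shear (z t)) - l t ^+ 2.
have mu' (t : R) : 0 <= t -> is_derive t 1 mu (s * lam_part (F (z t))).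
  by move=> t0; have d1 := is_derive_lam (z' t t0);
    apply: is_derive_eq; rewrite /= /GRing.scale/=; ring.
have W' (t : R) : 0 <= t -> is_derive t 1 W _ := fun t0 => is_derive_W (z' t t0).
have FE t : cone (z t) -> F (z t) = Phi (z t).
  by move=> /cone_r zr; rewrite /F cV_clamp_id.
have coneE t : cone (z t) <-> [/\ mu t < 0, - d < mu t & W t < 0].
  by split=> -[? ? ?]; split; rewrite // ?/W ?subr_lt0// -subr_lt0.
have dmu_ge t : cone (z t) -> cg * l t ^+ 2 <= s * lam_part (F (z t)).
  by move=> cz; rewrite FE// lamPhi; exact: cone_g_ge.
have mu_incr a T : 0 <= a <= T -> (forall t, a < t < T -> cone (z t)) -> mu a <= mu T.
  move=> /andP[a0 aT] cz; apply: (ge0_is_derive_le aT) => t tT.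
    by apply: mu'; case/andP: tT => + _; exact: le_trans.
  by apply: le_trans (dmu_ge t (cz t tT)); rewrite mulr_ge0 ?sqr_ge0// ltW.
have mu0 : [/\ mu 0 < 0, - d < mu 0 & W 0 < 0] by apply/coneE; rewrite z00.
have inv : forall t, 0 <= t -> cone (z t).
  apply: real_continuous_induction; first by rewrite z00.
  - move=> T T0 cT; have [mu00 mu0d W00] := mu0.
    have cz t : 0 < t < T -> cone (z t).
      by move=> /andP[t0 tT]; apply: cT; rewrite ltW.
    apply/coneE; split.
    (* l^2 = |l| |l| <= d (- mu) makes the quadratic upper bound on mu' linear in mu. *)
    + apply: (@gronwall_lt0 R mu (fun t => s * lam_part (F (z t))) (Cg * N ^+ 2 * d)) => //.
      * exact: ltW.
      * by move=> t /andP[t0 _]; exact: mu'.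
      * move=> t tT; have ct := cz t tT; rewrite FE// lamPhi.
        apply: le_trans (cone_g_le ct) _.
        have -> : - (Cg * N ^+ 2 * d) * mu t = Cg * N ^+ 2 * (d * - mu t) by ring.
        apply: ler_wpM2l; first by rewrite mulr_ge0 ?sqr_ge0// ltW.
        by rewrite -sqr_lam expr2 /mu -absl// ler_wpM2r// ltW// cone_lam.
    + by apply: (lt_le_trans mu0d); apply: mu_incr => //; rewrite lexx ltW.
    + apply: (@gronwall_lt0 R W _ (2 * al) _ _ (fun t tT => W' t (proj1 (andP tT)))) => //.
        exact: ltW.
      move=> t tT; have ct := cz t tT; have := cone_dV ct.
      by rewrite FE// -usubPhi -lamPhi.
  - move=> T T0 /coneE[m1 m2 W1].
    have cmu := is_derive_continuous (mu' T T0); have cW := is_derive_continuous (W' T T0).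
    have : \forall t \near T, cone (z t).
      near=> t; apply/coneE; split; near: t.
      + exact: (cvgr_lt _ cmu).
      + exact: (cvgr_gt _ cmu).
      + exact: (cvgr_lt _ cW).
    move=> /nbhs_ballP[eps /= eps0 epsC]; exists eps => // t /andP[Tt tT].
    apply: epsC; rewrite -ball_normE/= ltr_norml; apply/andP; split; lra.
have mu_to0 eta : 0 < eta -> exists2 T, 0 <= T & forall t, T <= t -> `|l t| < eta.
  move=> eta0; have [[T T0 muT]|none] := pselect (exists2 T, 0 <= T & - eta < mu T).
    exists T => // t Tt; have ct := inv _ (le_trans T0 Tt).
    rewrite absl// ltrNl; apply: (lt_le_trans muT); apply: mu_incr; first by rewrite T0.
    by move=> u /andP[Tu _]; apply: inv; rewrite (le_trans T0)// ltW.
  have mu_le t : 0 <= t -> mu t <= - eta.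
    by move=> t0; rewrite leNgt; apply/negP => H; apply: none; exists t.
  (* If mu stayed below - eta, its slope would be at least cg eta^2; by time [T] it would have risen
     by d, although it starts above - d and remains negative. *)
  pose T := d / (cg * eta ^+ 2).
  have ce0 : 0 < cg * eta ^+ 2 by rewrite mulr_gt0// exprn_gt0.
  have T0 : 0 <= T by rewrite divr_ge0 ?ltW.
  have id' (t : R) : is_derive t 1 (fun u => cg * eta ^+ 2 * u) (cg * eta ^+ 2).
    by apply: is_derive_eq; rewrite /= /GRing.scale/=; ring.
  have := @le_is_derive_le R (fun u => cg * eta ^+ 2 * u) (fun=> cg * eta ^+ 2) mu
    (fun t => s * lam_part (F (z t))) 0 T T0 (fun t _ => id' t).
  have cT : cg * eta ^+ 2 * T = d by rewrite /T mulrC divfK ?gt_eqF.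
  rewrite mulr0 subr0 cT => H.
  have : d <= mu T - mu 0.
    apply: H => t /andP[t0 _]; first exact: mu'.
    have ct := inv t (ltW t0); apply: le_trans (dmu_ge t ct).
    rewrite ler_pM2l// -sqr_lam ler_sqr ?nnegrE ?(ltW eta0)//.
    by rewrite absl//; have := mu_le t (ltW t0); rewrite /mu /l; lra.
  have := mu_le T T0; have [_ ? _] := mu0; lra.
have N0' := ltW N0.
have z_to0 eta : 0 < eta -> \forall t \near +oo, `|z t| <= eta.
  move=> eta0; have [|T T0 HT] := mu_to0 (eta / N); first by rewrite divr_gt0.
  near=> t; have Tt : T <= t by near: t; apply: nbhs_pinfty_ge; exact: num_real.
  apply: le_trans (cone_norm (inv _ (le_trans T0 Tt))) _.
  by rewrite mulrC -ler_pdivlMr// ltW// HT.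
have itv_ge0 t : t \in (`[0, +oo[%classic : set R) -> 0 <= t.
  by rewrite inE/= in_itv/= andbT.
exists (fun t => usubmx (z t)), l; split.
- split.
  + apply: continuous_in_subspaceT => t /itv_ge0 t0.
    exact: is_derive_continuous (is_derive_usub (z' t t0)).
  + apply: continuous_in_subspaceT => t /itv_ge0 t0.
    exact: is_derive_continuous (is_derive_lam (z' t t0)).
  + move=> t /ltW t0; have := is_derive_usub (z' t t0).
    by rewrite FE ?usubPhi//; exact: inv.
  + move=> t /ltW t0; have := is_derive_lam (z' t t0).
    by rewrite FE ?lamPhi//; exact: inv.
- by rewrite z00.
- by rewrite /l z00.
- apply/cvgrPdist_le => eta eta0; near=> t; rewrite sub0r normrN.
  by apply: le_trans (usub_norm _) _; near: t; exact: z_to0.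
- apply/cvgrPdist_le => eta eta0; near=> t; rewrite sub0r normrN.
  by apply: le_trans (lam_le_norm _) _; near: t; exact: z_to0.
Unshelve. all: by end_near. Qed.

Lemma cone_interior : exists z : 'cV[R]_(n + 1), nbhs z cone.
Proof.
(* The centre has s l = - d / 2, halfway up the cone, and its x-coordinate cancels the shear, so V
   vanishes there. *)
pose lc := - s * d / 2; pose zc : 'cV[R]_(n + 1) := col_mx (- lc *: q) (const_mx lc).
have lamc : lam_part zc = lc by rewrite /lam_part /zc col_mxEd mxE.
have shearc : shear zc = 0 by rewrite /shear lamc /zc col_mxKu scaleNr addNr.
have slc : s * lc = - (d / 2) by rewrite /lc mulrA mulrA mulrN s2; ring.
have q0 := normr_ge0 q.
(* Then c <= d / 8 and K c^2 <= (d / 8)^2, whereas l^2 stays at least (3 d / 8)^2. The radius is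
   divided by 1 + |q| because the shear can stretch norms by that factor. *)
pose c := d / (8 * (1 + K)).
have c0 : 0 < c by rewrite divr_gt0// mulr_gt0// addr_gt0.
have Kc : (1 + K) * c = d / 8 by rewrite /c; field; rewrite gt_eqF// addr_gt0.
have cd : c <= d / 8 by rewrite -Kc ler_peMl ?lerDl ?ltW.
have q1 : 0 < 1 + `|q| by rewrite ltr_wpDr.
exists zc; apply/nbhs_ballP; exists (c / (1 + `|q|)) => /=; first by rewrite divr_gt0.
move=> z; rewrite -ball_normE/= distrC ltr_pdivlMr// => zzc.
have lamB : lam_part (z - zc) = lam_part z - lc by rewrite -lamc /lam_part !mxE.
have shearB : shear z = shear (z - zc).
  rewrite -[LHS]subr0 -shearc /shear lamB lamc linearB/= scalerBl.
  by rewrite opprD addrACA.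
have lzc : `|lam_part z - lc| <= c.
  rewrite -lamB; apply: le_trans (lam_le_norm _) _; apply: le_trans (ltW zzc).
  by rewrite ler_peMr// lerDl.
have yc : `|shear z| <= c.
  rewrite shearB; apply: le_trans (ltW zzc); apply: le_trans (ler_normD _ _) _.
  rewrite normrZ mulrDr mulr1 lerD ?usub_norm//.
  by rewrite ler_wpM2r.
have sl : `|s * lam_part z + d / 2| <= c.
  have -> : s * lam_part z + d / 2 = s * (lam_part z - lc) by rewrite mulrBr slc opprK.
  by rewrite normrM norms mul1r.
move: sl; rewrite ler_norml => /andP[sl1 sl2].
split; [lra|lra|].
have -> : lam_part z ^+ 2 = (s * lam_part z) ^+ 2 by rewrite exprMn (expr2 s) s2 mul1r.
have Vc : V (shear z) <= K * (c * c).
  apply: le_trans (ler_norm _) _; apply: le_trans (PK _ _) _.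
  by rewrite -mulrA ler_pM2l// ler_pM.
apply: le_lt_trans Vc _.
have : K * (c * c) <= (d / 8) ^+ 2 by rewrite -Kc; nra.
nra.
Qed.

End ConeDynamics.

(** * Choice of the constants and conclusion *)

Lemma locally_lipschitz_at0 (R : realType) (V W : normedModType R) (h : V -> W) :
  locally_lipschitz h -> exists r L : R, [/\ 0 < r, 0 < L &
    forall z w, `|z| < r -> `|w| < r -> `|h z - h w| <= L * `|z - w|].
Proof.
move=> /(_ 0)[U /nbhs_ballP[r /= r0 rU] [M0 [_ hM]]].
exists r, (Num.max 0 M0 + 1); split => //; first by rewrite ltr_wpDl// le_max lexx.
move=> z w zr wr; have := hM (Num.max 0 M0 + 1) _ (z, w) _; apply.
  by rewrite ltr_pwDr// le_max lexx orbT.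
by split; apply: rU; rewrite -ball_normE/= sub0r normrN.
Qed.

Theorem theorem1 (R : realType) (n : nat) (hn : (1 <= n)%N)
    (f : 'cV[R]_n -> R -> 'cV[R]_n) (g : 'cV[R]_n -> R -> R)
    (A : 'M[R]_n) (b : 'cV[R]_n) (G : 'M[R]_(n + 1))
    (f_cont : continuous (joint f)) (g_cont : continuous (joint g))
    (f_lip : locally_lipschitz (joint f)) (g_lip : locally_lipschitz (joint g))
    (f_diff : differentiable (joint f) (0 : 'cV[R]_(n + 1)))
    (g_diff : differentiable (joint g) (0 : 'cV[R]_(n + 1)))
    (f0 : f 0 0 = 0) (g0 : g 0 0 = 0)
    (dfdx : forall v : 'cV[R]_n, 'd (fun x : 'cV[R]_n => f x 0) 0 v = A *m v)
    (dfdl : derive1 (fun l : R => f 0 l) 0 = b)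
    (dgdx : forall v : 'cV[R]_n, 'd (fun x : 'cV[R]_n => g x 0) 0 v = 0)
    (dgdl : derive1 (fun l : R => g 0 l) 0 = 0)
    (A_hurwitz : hurwitz A)
    (g_diff2 : twice_differentiable_at (joint g) (0 : 'cV[R]_(n + 1)))
    (G_hess : G = hessian (joint g) 0)
    (G_def : sign_definite G) :
  weak_attractor f g 0 0.
Proof.
split => //.
have joint0 (W : Type) (h : 'cV[R]_n -> R -> W) : joint h 0 = h 0 0.
  by rewrite /joint /lam_part linear0 mxE.
have [P [al [Psym Ppos al0 dissip]]] := hurwitz_lyapunov hn A_hurwitz.
have [K K0 PK] := bilinear_form_bound P.
have [p p0 Pp] := pos_definite_coercive Ppos.
(* Gives M^2 p = p + 2 + 1/p >= 1 without a square root. *)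
pose M := 1 + p^-1.
have pV0 : 0 < p^-1 by rewrite invr_gt0.
have M0 : 0 < M by rewrite addr_gt0.
have PM (v : 'cV[R]_n) : `|v| ^+ 2 <= M ^+ 2 * (v^T *m (P *m v)) ord0 ord0.
  have := ler_wpM2l (sqr_ge0 M) (Pp v); apply: le_trans; rewrite mulrA.
  have -> : M ^+ 2 * p = p + 2 + p^-1 by rewrite /M; field; rewrite gt_eqF.
  by rewrite ler_peMl ?sqr_ge0//; lra.
(* On a nonzero kernel vector the dissipation inequality would read 0 <= - al V with V > 0. *)
have Aunit : A \in unitmx.
  rewrite -unitmx_tr -row_free_unit; apply: inj_row_free => v vA.
  have Av : A *m v^T = 0 by rewrite -[A]trmxK -trmx_mul vA trmx0.
  apply/eqP; rewrite -(inj_eq (@trmx_inj _ _ _)) trmx0; apply/negPn/negP => v0.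
  have := Ppos _ v0; rewrite -mulmxA => Vpos.
  have := dissip v^T; rewrite Av !mulmx0 [leLHS]mxE mulNr oppr_ge0.
  by rewrite leNgt mulr_gt0.
pose q := invmx A *m b.
have Aq : A *m q = b by rewrite /q mulKVmx.
have grad0 : gradient (joint g) 0 = 0.
  apply/matrixP => i j; rewrite (ord1 j) !mxE /partial deriveE//.
  by rewrite diff_joint// dgdx dgdl scaler0 addr0.
have [s [c [s2 c0 Gc]]] : exists s c : R, [/\ s * s = 1, 0 < c &
    forall z : 'cV[R]_(n + 1), c * `|z| ^+ 2 <= s * (z^T *m (G *m z)) ord0 ord0].
  case: G_def => _ [Gpos|Gneg].
    have [c c0 Gc] := pos_definite_coercive Gpos.
    by exists 1, c; split; rewrite ?mulr1// => z; rewrite mul1r.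
  have NGpos : pos_definite (- G).
    by move=> v v0; rewrite mulmxN mulNmx mxE oppr_gt0 Gneg.
  have [c c0 Gc] := pos_definite_coercive NGpos.
  exists (-1), c; split; rewrite ?mulrNN ?mulr1// => z.
  by have := Gc z; rewrite mulNmx mulmxN mxE mulN1r.
have [KG KG0 GK] := bilinear_form_bound G.
(* Half the Hessian form is at least c/2 |z|^2 after multiplication by s; a Taylor error of c/4
   |z|^2 leaves c/4. *)
have c4 : 0 < c / 4 by rewrite divr_gt0.
have g00 : joint g 0 = 0 by rewrite joint0.
have [rg rg0 gT] := taylor2 g00 grad0 g_diff2 c4.
rewrite -G_hess in gT.
pose Cg := KG / 2 + c / 4.
have Cg0 : 0 < Cg by rewrite addr_gt0// divr_gt0.
have snorm : `|s| = 1.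
  by apply/eqP; rewrite -(@eqrXn2 _ 2) ?expr1n// -normrX expr2 s2 normr1.
have sg (z : 'cV[R]_(n + 1)) : `|z| < rg ->
    c / 4 * `|z| ^+ 2 <= s * joint g z <= Cg * `|z| ^+ 2.
  move=> /gT; set Q := (z^T *m (G *m z)) ord0 ord0; set g' := joint g z.
  have -> : `|g' - 2^-1 * Q| = `|s * g' - 2^-1 * (s * Q)|.
    by rewrite [2^-1 * (s * Q)]mulrCA -mulrBr normrM snorm mul1r.
  have sQ : s * Q <= KG * `|z| ^+ 2.
    apply: le_trans (ler_norm _) _; rewrite normrM snorm mul1r expr2 mulrA; exact: GK.
  have := Gc z; rewrite -/Q ler_norml /Cg => H1 /andP[H2 H3].
  apply/andP; split; lra.
pose N := M + `|q| + 1.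
have N0 : 0 < N by rewrite /N ltr_wpDl// addr_ge0// ltW.
have KMN0 : 0 < 2 * (K * M * N) by rewrite !mulr_gt0.
(* Half of the reserve: K M e N = al / 2. The other half bounds [D * d], where [D] collects the
   coefficients of [d] in [small]. *)
pose e := al / (2 * (K * M * N)).
have e0 : 0 < e by rewrite divr_gt0.
have [rf rf0 fT] := differentiable_expansion f_diff e0.
have [r1 [L1 [r10 L10 fL]]] := locally_lipschitz_at0 f_lip.
have [r2 [L2 [r20 L20 gL]]] := locally_lipschitz_at0 g_lip.
(* The local estimates hold on open balls; halving makes them valid on the closed ball of radius
   [r]. *)
pose r := Num.min (Num.min rf rg) (Num.min r1 r2) / 2.
have r'0 : 0 < Num.min (Num.min rf rg) (Num.min r1 r2) by rewrite !lt_min rf0 rg0 r10 r20.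
have r0 : 0 < r by rewrite divr_gt0.
have rlt : r < Num.min (Num.min rf rg) (Num.min r1 r2).
  by rewrite /r ltr_pdivrMr// mulr2n mulrDr mulr1 ltrDl.
have [rrf rrg rr1 rr2] : [/\ r < rf, r < rg, r < r1 & r < r2].
  by move: rlt; rewrite !lt_min => /andP[/andP[? ?] /andP[? ?]].
pose D := K * M * (Cg * N ^+ 2 * `|q|) + Cg * N ^+ 2.
have CN0 : 0 < Cg * N ^+ 2 by rewrite mulr_gt0// exprn_gt0.
have D0 : 0 < D by rewrite ltr_wpDl// !mulr_ge0// ltW.
pose d := Num.min (r / N) (al / (2 * D)).
have d0 : 0 < d by rewrite lt_min !divr_gt0// mulr_gt0.
have Nd : N * d <= r by rewrite mulrC -ler_pdivlMr// ge_min lexx.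
have Dd : D * d <= al / 2.
  apply: (@le_trans _ _ (D * (al / (2 * D)))).
    by rewrite ler_pM2l// ge_min lexx orbT.
  by rewrite le_eqVlt; apply/orP; left; apply/eqP; field; rewrite gt_eqF.
have small : K * M * (e * N + Cg * N ^+ 2 * `|q| * d) + Cg * N ^+ 2 * d <= al.
  have -> : K * M * (e * N + Cg * N ^+ 2 * `|q| * d) + Cg * N ^+ 2 * d = al / 2 + D * d.
    by rewrite /D /e; field; rewrite !gt_eqF.
  lra.
have [z zcone] := @cone_interior R n P q s K d s2 K0 PK d0.
apply: (@positive_lebesgue_measure_nbhs _ _ z); first by rewrite addn1.
apply: filterS zcone.
apply: (@cone_basin R n f g A P b q s al K M e (c / 4) Cg r (Num.max L1 L2) d) => //.
- move=> w wr; have := fT w (le_lt_trans wr rrf).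
  by rewrite addr0 joint0 f0 subr0 diff_joint// dfdx dfdl.
- by move=> w wr; have /andP[] := sg w (le_lt_trans wr rrg).
- by move=> w wr; have /andP[] := sg w (le_lt_trans wr rrg).
- by rewrite lt_max L10.
- move=> w w' wr w'r; apply: le_trans (fL _ _ (le_lt_trans wr rr1) (le_lt_trans w'r rr1)) _.
  by rewrite ler_wpM2r// le_max lexx.
- move=> w w' wr w'r; apply: le_trans (gL _ _ (le_lt_trans wr rr2) (le_lt_trans w'r rr2)) _.
  by rewrite ler_wpM2r// le_max lexx orbT.
Qed.
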